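(* Consider a Brill-Lindquist-Riemann sum for $(A,B)$ with $\mathcal P_{n,**}=\mathcal P_{n,*}$ for all $n$, and fix $R>\sqrt3D$. There exists a constant $C$ of class $\mathscr C$ for which $$\tfrac1C(R+\ell_nD)\le\mathrm{diam}_{g_n}(\mathcal V_{n,R})\le C(R+\ell_nD)$$ for all $n$ which are large relative to $\mathscr C$.
   Context: $g_{\mathbb E}$ is the Euclidean metric on $\mathbb R^3$, $B(p,r)$ the open Euclidean ball. Fix $D>0$ and smooth non-negative functions $A,B$ supported in $[-D,D]^3$. For each $n\in\mathbb N$ subdivide $[-D,D]^3$ into $(2n)^3$ boxes of side $D/n$, with centers $p_{i,n}$. A Brill-Lindquist-Riemann sum for $(A,B)$ is given by parameters $\alpha_{i,n},\beta_{i,n}\ge0$ with $$\mathscr C(\alpha,A):=\sup_{i,n}n^4|\alpha_{i,n}-A(p_{i,n})(D/n)^3|<\infty,\qquad\mathscr C(\beta,B):=\sup_{i,n}n^4|\beta_{i,n}-B(p_{i,n})(D/n)^3|<\infty,$$ and the metrics $g_n=(\chi_n\psi_n)^2g_{\mathbb E}$, where $\chi_n(x)=1+\sum_i\frac{\alpha_{i,n}}{|x-p_{i,n}|}$, $\psi_n(x)=1+\sum_i\frac{\beta_{i,n}}{|x-p_{i,n}|}$. Boxes with $\alpha_{i,n}=\beta_{i,n}=0$ are disregarded: $i$ ranges over boxes with $\alpha_{i,n}+\beta_{i,n}\ne0$. Put $\mathcal P_{n,*}=\{p_{i,n}:\alpha_{i,n}+\beta_{i,n}\ne0\}$, $\mathcal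 P_{n,**}=\{p_{i,n}:\alpha_{i,n}\beta_{i,n}\ne0\}$. When $\mathcal P_{n,**}=\mathcal P_{n,*}$, $\ell_n:=\frac1D\max_i(\alpha_{i,n}+\beta_{i,n})|\ln(\alpha_{i,n}\beta_{i,n}/D^2)|$. Constants of class $\mathscr C$ are polynomial expressions in $\|A\|D^2$, $\|B\|D^2$, $\mathscr C(\alpha,A)/D$, $\mathscr C(\beta,B)/D$ with universal non-negative real coefficients (Euclidean $L^\infty(\mathbb R^3)$-norms). A property holds for $n$ large relative to $\mathscr C$ if it holds for all $n\ge N$ for some $N$ of class $\mathscr C$. For $n$ large relative to $\mathscr C$ and each $p_{i,n}\in\mathcal P_{n,**}$ there is a unique closed minimal surface $\Sigma_{i,n}$ for $g_n$ contained in $|x-p_{i,n}|\le D/(2n)$, and it is of the form $\{p_{i,n}+\mathcal S_{i,n}(\omega)\omega:\omega\in S^2\}$ with $\mathcal S_{i,n}:S^2\to(0,\infty)$. Let $\mathrm{Out}_R(\Sigma_{i,n})$ be the connected component of $B(0,R)\smallsetminus\Sigma_{i,n}$ not containing $p_{i,n}$, and $\mathcal V_{n,R}:=\big(\bigcap_i\mathrm{Out}_R(\Sigma_{i,n})\big)\smallsetminus\mathcal P_{n,*}$, the intersection being over all $p_{i,n}\in\mathcal P_{n,**}$. $\mathrm{diam}_{g_n}(\mathcal V_{n,R})$ is the diameter with respect to the distance given by the infimum of $g_n$-lengths of paths inside $\mathcal V_{n,R}$. *)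

(* Defs.v *)
From HB Require Import structures.
From mathcomp Require Import all_boot all_order all_algebra.
From mathcomp Require mpoly.
From mathcomp Require Import all_classical all_reals all_analysis.

Set Implicit Arguments.
Unset Strict Implicit.
Unset Printing Implicit Defensive.

Import Order.TTheory GRing.Theory Num.Theory.
Import numFieldNormedType.Exports.
Local Open Scope classical_set_scope.
Local Open Scope ring_scope.

Section EuclideanSpace.
Context {R : realType}.
Local Notation E := 'rV[R]_3.

(* The library norm on row vectors is the sup norm; it only serves for the
   topology and for derivatives. *)
Definition enorm (v : E) : R := Num.sqrt (\sum_(k < 3) v 0 k ^+ 2).

Definition eball (p : E) (r : R) : set E := [set x | enorm (x - p) < r].

Definition ecball (p : E) (r : R) : set E := [set x | enorm (x - p) <= r].

Definition cube (D : R) : set E := [set x | forall k, - D <= x 0 k <= D].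

Definition pderiv (k : 'I_3) (f : E -> R) (x : E) : R := 'D_(delta_mx 0 k) f x.

(* Class C^oo: every iterated partial derivative is differentiable. *)
Definition smooth (f : E -> R) : Prop :=
  forall s : seq 'I_3, forall x, differentiable (foldr pderiv f s) x.

Definition fsupport (f : E -> R) : set E := closure [set x | f x != 0].

(* L^oo norm of a continuous function. *)
Definition supnorm (f : E -> R) : R := sup [set `|f x| | x in [set: E]].

End EuclideanSpace.

Section RiemannianGeometry.
Context {R : realType}.
Local Notation E := 'rV[R]_3.
(* A Riemannian metric in the Cartesian coordinates of R^3. *)
Variable g : E -> 'M[R]_3.

Definition gnorm (x v : E) : R := Num.sqrt ((v *m g x *m v^T) 0 0).

Definition ggrad (F : E -> R) (x : E) : E :=
  \row_k \sum_(l < 3) invmx (g x) k l * pderiv l F x.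

Definition unit_normal (F : E -> R) (x : E) : E :=
  (gnorm x (ggrad F x))^-1 *: ggrad F x.

(* Gamma^k_{ij} of the Levi-Civita connection. *)
Definition christoffel (k i j : 'I_3) (x : E) : R :=
  2^-1 * \sum_(l < 3) invmx (g x) k l *
    (pderiv i (fun y => g y j l) x + pderiv j (fun y => g y i l) x
     - pderiv l (fun y => g y i j) x).

(* k-th component of the covariant derivative of N along the i-th coordinate
   field. *)
Definition covderiv (N : E -> E) (i k : 'I_3) (x : E) : R :=
  pderiv i (fun y => N y 0 k) x + \sum_(j < 3) christoffel k i j x * N x 0 j.

(* Mean curvature at x of the level set of F through x: the trace of the shape
   operator X |-> nabla_X N.  As N is a unit field, nabla_N N is orthogonal to
   N, so the trace over R^3 is the trace over the tangent plane. *)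
Definition mean_curvature (F : E -> R) (x : E) : R :=
  \sum_(i < 3) covderiv (unit_normal F) i i x.

(* Closed (compact, connected, without boundary) embedded smooth surface
   contained in M, with zero mean curvature for g.  The surface is described
   near each of its points as a regular level set; a local defining function
   can be taken smooth on the whole space after shrinking U. *)
Definition closed_minimal_surface (M S : set E) : Prop :=
  [/\ S !=set0, compact S, connected S, S `<=` M &
      forall x, S x -> exists (U : set E) (F : E -> R),
        [/\ open U, U x, smooth F, S `&` U = [set y | F y = 0] `&` U &
            forall y, (S `&` U) y ->
              (exists k, pderiv k F y != 0) /\ mean_curvature F y = 0]].

(* A C^1 arc parametrized by [0, 1]; such a map always extends to a C^1 map on
   the real line. *)
Definition C1_arc (c : R -> E) : Prop :=
  (forall t, derivable c t 1) /\ continuous (derive1 c).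

Definition arc_length (c : R -> E) : R :=
  \int[lebesgue_measure]_(t in `[0, 1]) gnorm (c t) (derive1 c t).

(* A piecewise C^1 path in V from x to y, as the list of its C^1 pieces. *)
Fixpoint is_path (V : set E) (x : E) (cs : seq (R -> E)) (y : E) : Prop :=
  if cs is c :: cs' then
    [/\ C1_arc c, (forall t, 0 <= t <= 1 -> V (c t)), c 0 = x &
        is_path V (c 1) cs' y]
  else x = y.

Definition path_length (cs : seq (R -> E)) : R :=
  \sum_(c <- cs) arc_length c.

Definition gdist (V : set E) (x y : E) : \bar R :=
  ereal_inf [set (path_length cs)%:E | cs in [set cs | is_path V x cs y]].

Definition gdiam (V : set E) : \bar R :=
  ereal_sup [set gdist V xy.1 xy.2 | xy in V `*` V].

End RiemannianGeometry.

Notation box n := {ffun 'I_3 -> 'I_(2 * n)}.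

Section BrillLindquistRiemann.
Context {R : realType}.
Local Notation E := 'rV[R]_3.
Variable D : R.

Definition center (n : nat) (i : box n) : E :=
  \row_k (- D + ((i k)%:R + 2^-1) * (D / n%:R)).

(* There are no boxes for n = 0. *)
Definition defects (A : E -> R) (alpha : forall n, box n -> R) : set R :=
  [set r | exists (n : nat) (i : box n),
     r = n%:R ^+ 4 * `|alpha n i - A (center i) * (D / n%:R) ^+ 3|].

Definition defect (A : E -> R) (alpha : forall n, box n -> R) : R :=
  sup (defects A alpha).

Definition BLR_sum (A B : E -> R) (alpha beta : forall n, box n -> R) : Prop :=
  [/\ forall n (i : box n), 0 <= alpha n i,
      forall n (i : box n), 0 <= beta n i,
      has_ubound (defects A alpha) & has_ubound (defects B beta)].

(* The four quantities in which the constants of class C are polynomial. *)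
Definition class_params (A B : E -> R) (alpha beta : forall n, box n -> R)
    (k : 'I_4) : R :=
  [:: supnorm A * D ^+ 2; supnorm B * D ^+ 2;
      defect A alpha / D; defect B beta / D]`_k.

(* Value, for the given data, of the constant of class C whose polynomial
   expression is P. *)
Definition class_const (P : mpoly.mpoly 4 R) (A B : E -> R)
    (alpha beta : forall n, box n -> R) : R :=
  mpoly.meval (class_params A B alpha beta) P.

Variables (n : nat) (alpha beta : box n -> R).

(* Boxes with alpha i = beta i = 0 contribute zero. *)
Definition potential (a : box n -> R) (x : E) : R :=
  1 + \sum_i a i / enorm (x - center i).

Definition BLR_metric (x : E) : 'M[R]_3 :=
  ((potential alpha x * potential beta x) ^+ 2)%:M.

Definition Pstar : set E :=
  [set center i | i in [set i | alpha i + beta i != 0]].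

Definition Pstarstar : set E :=
  [set center i | i in [set i | alpha i * beta i != 0]].

Definition ell : R :=
  D^-1 * \big[Num.max/0]_(i | alpha i + beta i != 0)
           ((alpha i + beta i) * `|ln (alpha i * beta i / D ^+ 2)|).

(* S is a closed minimal surface for the metric, contained in the closed ball
   of radius D / (2n) about the center of box i, of the form
   { p + r(w) w : w in the unit sphere }. *)
Definition neck_surface (i : box n) (S : set E) : Prop :=
  [/\ closed_minimal_surface BLR_metric (~` Pstar) S,
      S `<=` ecball (center i) (D / (2 * n%:R)) &
      exists r : E -> R,
        (forall w, enorm w = 1 -> 0 < r w) /\
        S = [set center i + r w *: w | w in [set w | enorm w = 1]]].

(* The points of B(0, rad) \ S whose component does not contain p. *)
Definition Out (rad : R) (p : E) (S : set E) : set E :=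
  [set x | (eball 0 rad `\` S) x /\
           ~ connected_component (eball 0 rad `\` S) x p].

(* The intersection is taken inside B(0, rad), which matters only when it is
   indexed by the empty set. *)
Definition outer_region (rad : R) (Sigma : box n -> set E) : set E :=
  (eball 0 rad `&`
   \bigcap_(i in [set i | alpha i * beta i != 0])
      Out rad (center i) (Sigma i)) `\` Pstar.

End BrillLindquistRiemann.

(* Main.v *)
(** Write [f] for the conformal factor [chi * psi] and [s] for the sum of the
    four class parameters, so that every mass is at most [s D / n ^ 3].

    Near the center [p] of a box with masses [a] and [b], up to a background
    which is bounded by [O(s)] with gradient [O(s / D)],
    [f] is [(1 + a / r) (1 + b / r)], and the sphere of radius [r] about [p] has
    vanishing mean curvature at [r = sqrt (a b)].  Comparing the minimal surface
    with the Euclidean spheres through its nearest and farthest points pins its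
    distance to [p] between two multiples of [sqrt (a b)]; the comparison only
    uses that a defining function keeps a constant sign on the empty side of the
    sphere, and is carried out along rotations about the coordinate axes.

    Upper bound: from a point of the region go radially to the face of its box,
    at cost [O((1 + s) ^ 2 (D + (a + b) |ln (a b / D ^ 2)|))], then to the origin
    inside coordinate planes through faces of boxes, which stay at distance
    [D / (2 n)] from all centers, so that [f = O((1 + s) ^ 2)] there.  Lower bound: [f >= 1] gives
    [rad], and [f >= (a + b) / r] makes [(a + b) ln r] a lower bound for the
    length of any path leaving a neck. *)

Require Import Defs.
From HB Require Import structures.
From mathcomp Require Import all_boot all_order all_algebra.
From mathcomp Require mpoly.
From mathcomp Require Import all_classical all_reals all_analysis.
From mathcomp Require Import ring lra.
Import Order.TTheory GRing.Theory Num.Theory.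
Import numFieldNormedType.Exports.
Local Open Scope classical_set_scope.
Local Open Scope ring_scope.

Set Implicit Arguments.
Unset Strict Implicit.
Unset Printing Implicit Defensive.

(** * Derivatives and the second derivative test *)

(** All that is known of a neck near one of its points is a smooth function vanishing exactly on it
    there, with nonzero gradient on it. Extremal distances are therefore studied on two-parameter
    families, displacement off the sphere and angle of rotation: the intermediate value theorem
    carries a sign from the empty side to the sphere, and a one-variable second derivative test does
    the rest. Likewise the radial function of a neck is an arbitrary function, and compactness of
    the surface has to stand in for its continuity.

    The deciding quantity is [1 + r d_r ln f]. Multiplied by [f], it becomes [1 - a b / r ^ 2] in
    the model, because the terms linear in the masses cancel. The errors must stay below [1 / 8];
    they are at most [48 s / n] and, against the other mass, [96 s ^ 2 / n ^ 3], which is why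
    [n >= 1000 (1 + s)] is required. The lower bound for the radius loses a factor depending on [s];
    in a length this costs only a multiple of [(1 + 104 s) ^ 2 D]. *)

Section DirectionalDerivatives.
Context {R : realType} {V : normedModType R}.
Implicit Types (f g : V -> R) (x v : V).

(** Only the derivative of [f] along [v] is given, so the chain rule is applied to the one-variable
    function [t |-> f (t *: v + x)] at 0. *)
Lemma is_derive_compr (h : R -> R) f x v (a b : R) :
  is_derive (f x) 1 h a -> is_derive x v f b ->
  is_derive x v (fun z => h (f z)) (a * b).
Proof.
move=> dh df.
pose l (t : R) := f (t *: v + x).
have lE : l 0 = f x by rewrite /l scale0r add0r.
have dl : is_derive (0 : R) 1 l b.
  apply: DeriveDef.
    by apply: (derivable1P f x v).1; exact: (@ex_derive _ _ _ _ _ _ _ df).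
  have <- : 'D_v f x = b by case: df.
  rewrite /derive; apply: (f_equal (fun F : R -> R => lim (F @ 0^'))).
  by apply/funext => t; rewrite /l /= [_%:A]mulr1 addr0 scale0r add0r.
have dhl : is_derive (0 : R) 1 (h \o l) (a * b).
  by apply: is_derive1_comp; rewrite lE.
apply: DeriveDef.
  by apply: (derivable1P _ x v).2; exact: (@ex_derive _ _ _ _ _ _ _ dhl).
have <- : 'D_1 (h \o l) 0 = a * b by case: dhl.
rewrite /derive; apply: (f_equal (fun F : R -> R => lim (F @ 0^'))).
by apply/funext => t; rewrite /l /= [_%:A]mulr1 addr0 scale0r add0r.
Qed.

Lemma is_derive_mulr f g x v (a b : R) :
  is_derive x v f a -> is_derive x v g b ->
  is_derive x v (fun z => f z * g z) (a * g x + f x * b).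
Proof.
move=> df dg; apply: (is_derive_eq (@is_deriveM _ _ f g x v a b df dg)).
by rewrite /GRing.scale /=; ring.
Qed.

Lemma is_derive_addr f g x v (a b : R) :
  is_derive x v f a -> is_derive x v g b ->
  is_derive x v (fun z => f z + g z) (a + b).
Proof. by move=> df dg; exact: (@is_deriveD _ _ _ f g x v a b df dg). Qed.

Lemma is_derive_sumr (I : Type) (r : seq I) (P : pred I) (f : I -> V -> R)
    x v (a : I -> R) :
  (forall i, P i -> is_derive x v (f i) (a i)) ->
  is_derive x v (fun z => \sum_(i <- r | P i) f i z) (\sum_(i <- r | P i) a i).
Proof.
move=> df; elim: r => [|i r ih].
  under eq_fun do rewrite big_nil.
  by rewrite big_nil; exact: is_derive_cst.
under eq_fun do rewrite big_cons.
rewrite big_cons; case: ifP => // Pi.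
by apply: is_derive_addr => //; exact: df.
Qed.

Lemma is_derive_invr f x v (a : R) : f x != 0 -> is_derive x v f a ->
  is_derive x v (fun z => (f z)^-1) (- (a / f x ^+ 2)).
Proof.
move=> f0 df; apply: DeriveDef; first exact: derivableV.
rewrite deriveV // derive_val /GRing.scale /= -exprVn.
by rewrite mulNr mulrC exprVn.
Qed.

Lemma is_derive_sqrt f x v (a : R) : 0 < f x -> is_derive x v f a ->
  is_derive x v (fun z => Num.sqrt (f z)) (a / (2 * Num.sqrt (f x))).
Proof.
move=> f0 df; rewrite mulrC; apply: is_derive_compr df.
exact: is_derive1_sqrt.
Qed.

End DirectionalDerivatives.

Section ChainRule.
Context {R : realType}.
Local Notation E := 'rV[R]_3.
Implicit Types (F : E -> R) (c : R -> E).

Lemma derive_pderiv F (x v : E) : differentiable F x ->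
  'D_v F x = \sum_k pderiv k F x * v 0 k.
Proof.
move=> dF; rewrite deriveE // [in LHS](row_sum_delta v) linear_sum /=.
apply: eq_bigr => k _; rewrite linearZ /= mulrC; congr (_ * _).
by rewrite /pderiv deriveE.
Qed.

Lemma is_derive_curve F c (t : R) (dc : 'I_3 -> R) :
  differentiable F (c t) ->
  (forall k, is_derive t 1 (fun u => c u 0 k) (dc k)) ->
  is_derive t 1 (fun u => F (c u)) (\sum_k pderiv k F (c t) * dc k).
Proof.
move=> dF dck.
have cd : derivable c t 1.
  by apply/derivable_mxP => i j; rewrite ord1; case: (dck j).
have cD : differentiable c t by apply/derivable1_diffP.
apply: DeriveDef.
  by apply/derivable1_diffP; exact: differentiable_comp.
rewrite deriveE; last exact: differentiable_comp.
rewrite -[X in 'd X t 1]/(F \o c) diff_comp //=.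
rewrite -deriveE // -deriveE // derive_pderiv //.
apply: eq_bigr => k _; congr (_ * _); rewrite derive_mx // mxE.
by case: (dck k).
Qed.

End ChainRule.

Section OneVariable.
Context {R : realType}.

Lemma is_derive_lt0 (f : R -> R) (a : R) : is_derive (0 : R) 1 f a -> a < 0 ->
  exists2 d : R, 0 < d & forall t, 0 < t < d -> f t < f 0.
Proof.
move=> [/cvg_ex[l hl] eda] a0.
have el : l = a by rewrite -eda; apply/esym/cvg_lim.
move: hl => /cvgrPdist_lt /(_ (- a)); rewrite oppr_gt0 => /(_ a0).
move=> [/= d d0 Hd]; exists d => // t /andP[t0 td].
have := Hd t; rewrite /= sub0r normrN gtr0_norm // => /(_ td).
rewrite gt_eqF // => /(_ isT); rewrite el /GRing.scale /= mulr1 addr0.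
rewrite ltr_norml => /andP[h _].
have : t^-1 * (f t - f 0) < 0 by move: h; lra.
by rewrite pmulr_rlt0 ?invr_gt0 // subr_lt0.
Qed.

Lemma is_derive_right_min (f : R -> R) (a e : R) : 0 < e ->
  is_derive (0 : R) 1 f a -> (forall t, 0 < t < e -> f 0 <= f t) -> 0 <= a.
Proof.
move=> e0 df fmin; rewrite leNgt; apply/negP => /(is_derive_lt0 df)[d d0 fd].
have /fd : 0 < Num.min d e / 2 < d.
  by rewrite minEle; case: (leP d e) => ?; apply/andP; split; lra.
by rewrite ltNge fmin // minEle; case: (leP d e) => ?; apply/andP; split; lra.
Qed.

(** If [d2] were negative, [dphi] would be negative just to the right of 0, and the mean value
    theorem would take [phi] below its minimum. *)
Lemma second_derivative_test (phi dphi : R -> R) (d2 e : R) : 0 < e ->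
  (forall t : R, is_derive t 1 phi (dphi t)) -> is_derive (0 : R) 1 dphi d2 ->
  (forall t, `|t| < e -> phi 0 <= phi t) -> dphi 0 = 0 /\ 0 <= d2.
Proof.
move=> e0 dp ddp pmin.
have dphi0 : dphi 0 = 0.
  have /= := @derive1_at_min R phi (- e) e 0 _ _ _ _.
  case.
  - by lra.
  - by move=> t _; case: (dp t).
  - by rewrite in_itv /=; apply/andP; split; lra.
  - move=> t; rewrite in_itv /= => /andP[t1 t2]; apply: pmin.
    by rewrite ltr_norml t1.
  by move=> _; case: (dp 0) => _ ->.
split => //; rewrite leNgt; apply/negP => /(is_derive_lt0 ddp)[d d0 Hd].
pose u := Num.min d e / 2.
have u0 : 0 < u by rewrite divr_gt0 // lt_min d0.
have ud : u < d by rewrite /u minEle; case: (leP d e) => ?; lra.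
have ue : u < e by rewrite /u minEle; case: (leP d e) => ?; lra.
have [|c + h] := @MVT R phi dphi 0 u u0 (fun x _ => dp x).
  apply: derivable_within_continuous => x _.
  by case: (dp x).
rewrite in_itv /= => /andP[c0 cu].
have := pmin u; rewrite gtr0_norm // => /(_ ue).
rewrite -subr_ge0 h subr0 pmulr_lge0 // -dphi0 leNgt Hd //.
by rewrite c0 (lt_trans cu).
Qed.

Lemma IVT_opposite_signs (f : R -> R) (a b : R) : a <= b -> continuous f ->
  f a * f b < 0 -> exists2 c, a <= c <= b & f c = 0.
Proof.
move=> ab cf fab.
have [|c + fc] := @IVT R f a b 0 ab (continuous_subspaceT cf).
  have [fa0|fa0|fa0] := ltgtP (f a) 0.
  - have fb0 : 0 < f b by rewrite -(nmulr_rlt0 _ fa0).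
    by rewrite minEle maxEle (ltW (lt_trans fa0 fb0)) (ltW fa0) (ltW fb0).
  - have fb0 : f b < 0 by rewrite -(pmulr_rlt0 _ fa0).
    have ba : (f a <= f b) = false by rewrite leNgt (lt_trans fb0 fa0).
    by rewrite minEle maxEle ba (ltW fa0) (ltW fb0).
  - by move: fab; rewrite fa0 mul0r ltxx.
by rewrite in_itv /=; exists c.
Qed.

(** [H] keeps one sign on the open strip, by the intermediate value theorem in each variable, and
    the edge [s = 0] inherits it weakly. In the application [s] measures the displacement to the
    empty side of a sphere and [t] the position along a curve on it. *)
Lemma nonvanishing_same_sign (H : R -> R -> R) (e s t : R) :
  (forall s, continuous (H s)) -> (forall t, continuous (H ^~ t)) ->
  (forall s t, 0 < s < e -> `|t| < e -> H s t != 0) ->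
  0 < s < e -> `|t| < e -> 0 <= H s 0 * H 0 t.
Proof.
move=> cH1 cH2 Hne0 se te; have s0 : 0 < s by case/andP: se.
have e0 : 0 < e by exact: le_lt_trans te.
have Hst : 0 < H s 0 * H s t.
  have Hs0 := Hne0 s 0 se; rewrite normr0 in Hs0.
  rewrite lt_def mulf_neq0 ?Hne0 ?normr0 //= leNgt; apply/negP => neg.
  have [t0|t0] := leP 0 t.
    have [c /andP[c1 c2] Hc] := IVT_opposite_signs t0 (cH1 s) neg.
    suff /(Hne0 s c se) : `|c| < e by rewrite Hc eqxx.
    by move: te; rewrite !ger0_norm //; exact: le_lt_trans.
  rewrite mulrC in neg.
  have [c /andP[c1 c2] Hc] := IVT_opposite_signs (ltW t0) (cH1 s) neg.
  suff /(Hne0 s c se) : `|c| < e by rewrite Hc eqxx.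
  by move: te; rewrite (ltr0_norm t0) ler0_norm //; apply: le_lt_trans; rewrite lerN2.
rewrite leNgt; apply/negP => neg.
have H0t : H 0 t * H s t < 0.
  have : (H s 0 * H 0 t) * (H s 0 * H s t) < 0 by rewrite pmulr_llt0.
  by rewrite mulrACA pmulr_rlt0 // -expr2 exprn_even_gt0 //= Hne0 ?normr0.
have [c /andP[c1 c2] Hc] := IVT_opposite_signs (ltW s0) (cH2 t) H0t.
(* A zero at [c = 0] would make the strictly negative product [H0t] vanish; every other zero lies in
   the strip. *)
have c0 : 0 < c.
  rewrite lt_def c1 andbT; apply/eqP => c0; move: Hc H0t; rewrite c0 => ->.
  by rewrite mul0r ltxx.
suff /Hne0 /(_ te) : 0 < c < e by rewrite Hc eqxx.
by rewrite c0; case/andP: se => _; exact: le_lt_trans.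
Qed.

End OneVariable.

(** * Euclidean geometry *)

Local Notation i0 := (@Ordinal 3 0 isT).
Local Notation i1 := (@Ordinal 3 1 isT).
Local Notation i2 := (@Ordinal 3 2 isT).

Lemma sum_I3 (V : zmodType) (f : 'I_3 -> V) : \sum_k f k = f i0 + f i1 + f i2.
Proof.
rewrite !big_ord_recl big_ord0 addr0 addrA.
by congr (f _ + f _ + f _); apply/val_inj.
Qed.

Lemma forall_I3 (P : 'I_3 -> Prop) : P i0 -> P i1 -> P i2 -> forall k, P k.
Proof.
move=> P0 P1 P2 [[|[|[|//]]] lt_k].
- by rewrite (_ : Ordinal _ = i0) //; exact: val_inj.
- by rewrite (_ : Ordinal _ = i1) //; exact: val_inj.
- by rewrite (_ : Ordinal _ = i2) //; exact: val_inj.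
Qed.

Lemma cvg_sumr {R : realType} {T : Type} (F : set_system T) {FF : Filter F}
    (I : Type) (r : seq I) (P : pred I) (f : I -> T -> R) (l : I -> R) :
  (forall i, P i -> f i x @[x --> F] --> l i) ->
  \sum_(i <- r | P i) f i x @[x --> F] --> \sum_(i <- r | P i) l i.
Proof.
move=> h; elim: r => [|i r ih].
  under eq_fun do rewrite big_nil.
  by rewrite big_nil; exact: cvg_cst.
under eq_fun do rewrite big_cons.
by rewrite big_cons; case: ifP => // Pi; apply: cvgD => //; exact: h.
Qed.

Section EuclideanNorm.
Context {R : realType}.
Local Notation E := 'rV[R]_3.
Implicit Types (u v w : E).

Lemma sqr_enorm v : enorm v ^+ 2 = \sum_k v 0 k ^+ 2.
Proof. by rewrite sqr_sqrtr // sumr_ge0 // => k _; exact: sqr_ge0. Qed.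

Lemma enorm_ge0 v : 0 <= enorm v.
Proof. exact: sqrtr_ge0. Qed.

Lemma enorm0 : enorm (0 : E) = 0.
Proof. by rewrite /enorm big1 ?sqrtr0 // => k _; rewrite mxE expr0n. Qed.

Lemma enorm_eq0 v : (enorm v == 0) = (v == 0).
Proof.
apply/eqP/eqP => [v0|->]; last exact: enorm0.
have := sqr_enorm v; rewrite v0 expr0n /= => /esym/eqP.
rewrite psumr_eq0 => [/allP h|k _]; last exact: sqr_ge0.
apply/rowP => k; rewrite mxE; apply/eqP; rewrite -sqrf_eq0.
by apply: h; rewrite mem_index_enum.
Qed.

Lemma enorm_gt0 v : (0 < enorm v) = (v != 0).
Proof. by rewrite lt_def enorm_eq0 enorm_ge0 andbT. Qed.

Lemma enormZ (a : R) v : enorm (a *: v) = `|a| * enorm v.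
Proof.
rewrite /enorm -sqrtr_sqr -sqrtrM ?sqr_ge0 // mulr_sumr.
by congr Num.sqrt; apply: eq_bigr => k _; rewrite mxE exprMn.
Qed.

Lemma enormN v : enorm (- v) = enorm v.
Proof. by rewrite -scaleN1r enormZ normrN1 mul1r. Qed.

Lemma enormBC u v : enorm (u - v) = enorm (v - u).
Proof. by rewrite -enormN opprB. Qed.

Lemma cauchy_schwarz u v : \sum_k u 0 k * v 0 k <= enorm u * enorm v.
Proof.
apply: le_trans (ler_norm _) _.
rewrite -(@ler_pXn2r _ 2) ?nnegrE ?mulr_ge0 ?enorm_ge0 //.
rewrite real_normK ?num_real // exprMn !sqr_enorm !sum_I3.
set a := u 0 i0; set b := u 0 i1; set c := u 0 i2.
set x := v 0 i0; set y := v 0 i1; set z := v 0 i2.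
rewrite -subr_ge0 [leRHS](_ : _ =
  (a * y - b * x) ^+ 2 + (a * z - c * x) ^+ 2 + (b * z - c * y) ^+ 2).
  by rewrite !addr_ge0 ?sqr_ge0.
by ring.
Qed.

Lemma norm_dot_le u v : `|\sum_k u 0 k * v 0 k| <= enorm u * enorm v.
Proof.
rewrite ler_norml cauchy_schwarz andbT lerNl -(enormN u) -sumrN.
rewrite (eq_bigr (fun k => (- u) 0 k * v 0 k)) ?cauchy_schwarz //.
by move=> k _; rewrite mxE mulNr.
Qed.

Lemma ler_enormD u v : enorm (u + v) <= enorm u + enorm v.
Proof.
rewrite -(@ler_pXn2r _ 2) ?nnegrE ?addr_ge0 ?enorm_ge0 //.
have := cauchy_schwarz u v; rewrite sqrrD !sqr_enorm !sum_I3 !mxE.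
by move=> h; rewrite -subr_ge0 in h *; move: h; lra.
Qed.

Lemma coord_le_enorm v k : `|v 0 k| <= enorm v.
Proof.
rewrite -(@ler_pXn2r _ 2) ?nnegrE ?enorm_ge0 // real_normK ?num_real //.
rewrite sqr_enorm (bigD1 k) //= lerDl sumr_ge0 // => l _; exact: sqr_ge0.
Qed.

(** The factor 2 rounds up the square root of 3. *)
Lemma enorm_le_coord v (d : R) : (forall k, `|v 0 k| <= d) -> enorm v <= 2 * d.
Proof.
move=> h; have d0 : 0 <= d by exact: le_trans (h i0).
rewrite -(@ler_pXn2r _ 2) ?nnegrE ?mulr_ge0 ?enorm_ge0 // sqr_enorm.
have : \sum_k v 0 k ^+ 2 <= \sum_(k < 3) d ^+ 2.
  apply: ler_sum => k _; rewrite -(@real_normK _ (v 0 k)) ?num_real //.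
  by rewrite ler_pXn2r ?nnegrE.
move=> /le_trans; apply; rewrite sumr_const card_ord exprMn; have := sqr_ge0 d; lra.
Qed.

Lemma enorm_continuous : continuous (@enorm R).
Proof.
move=> v; apply: (@continuous_comp _ _ _ (fun v => \sum_k v 0 k ^+ 2)).
  apply: (@cvg_sumr R E (nbhs v) _) => k _.
  apply: (@continuous_comp _ _ _ (fun v => v 0 k) (fun t => t ^+ 2)).
    exact: coord_continuous.
  exact: exprn_continuous.
exact: sqrt_continuous.
Qed.

(** [W] is the space itself for the gradient of the distance to a center, and the line for the
    distance along an arc. *)
Lemma is_derive_enorm_curve (W : normedModType R) (c : W -> E) (x v : W)
    (dc : 'I_3 -> R) :
  (forall k, is_derive x v (fun y => c y 0 k) (dc k)) -> c x != 0 ->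
  is_derive x v (fun y => enorm (c y)) ((\sum_k c x 0 k * dc k) / enorm (c x)).
Proof.
move=> dck cx0; have e0 : 0 < enorm (c x) by rewrite enorm_gt0.
have ds : is_derive x v (fun y => \sum_k c y 0 k ^+ 2)
    (2 * \sum_k c x 0 k * dc k).
  have -> : (fun y => \sum_k c y 0 k ^+ 2) =
      (fun y => \sum_k c y 0 k * c y 0 k).
    by apply/funext => y; apply: eq_bigr => j _; rewrite expr2.
  apply: (is_derive_eq (@is_derive_sumr _ _ _ _ _ _ _ _ _
     (fun k _ => is_derive_mulr (dck k) (dck k)))).
  by rewrite mulr_sumr; apply: eq_bigr => k _; ring.
have s0 : 0 < \sum_k c x 0 k ^+ 2 by rewrite -sqr_enorm exprn_gt0.
apply: (is_derive_eq (is_derive_sqrt s0 ds)).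
by rewrite -/(enorm _); field; rewrite gt_eqF.
Qed.

End EuclideanNorm.

Section Touching.
Context {R : realType}.
Local Notation E := 'rV[R]_3.
Implicit Types (F : E -> R) (p v a b : E).

(** Rodrigues' formula: if [a] is the cross product of a unit vector [e] with [v], and [b] that of
    [e] with [a], then [v] is turned by the angle [t] about [e] and dilated by [1 + s]. *)
Definition rotation_point p v a b (s t : R) : E :=
  p + (1 + s) *: (v + sin t *: a + (1 - cos t) *: b).

Lemma rotation_point_continuous p v a b :
  continuous (fun z : R * R => rotation_point p v a b z.1 z.2).
Proof.
move=> z; apply: cvgD; first exact: cvg_cst.
apply: cvgZ.
  by apply: cvgD; [exact: cvg_cst | exact: cvg_fst].
apply: cvgD; first apply: cvgD; first exact: cvg_cst.
  apply: cvgZr_tmp.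
  apply: (@continuous_comp _ _ _ snd sin); first exact: cvg_snd.
  exact: continuous_sin.
apply: cvgZr_tmp; apply: cvgB; first exact: cvg_cst.
apply: (@continuous_comp _ _ _ snd cos); first exact: cvg_snd.
exact: continuous_cos.
Qed.

Lemma rotation_point_near p v a b (U : set E) : nbhs (p + v) U ->
  exists2 d : R, 0 < d & forall s t, `|s| < d -> `|t| < d ->
    U (rotation_point p v a b s t).
Proof.
move=> Uv; have := @rotation_point_continuous p v a b (0, 0).
rewrite /continuous_at /= /rotation_point /= addr0 scale1r sin0 cos0 scale0r.
rewrite subrr scale0r !addr0 => /(_ _ Uv)[[A B] /= [/nbhs_ballP[d1 /= d10 hA]]].
move=> /nbhs_ballP[d2 /= d20 hB] hAB; exists (Num.min d1 d2).
  by rewrite lt_min d10.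
move=> s t; rewrite !lt_min => /andP[s1 _] /andP[_ t2].
apply: (hAB (s, t)); split => /=.
  by apply: hA; rewrite /ball /= sub0r normrN.
by apply: hB; rewrite /ball /= sub0r normrN.
Qed.

End Touching.

(** * Level sets touching a sphere *)

Section TouchingSphere.
Context {R : realType}.
Local Notation E := 'rV[R]_3.
Implicit Types (F : E -> R) (p v a b : E).

Lemma smooth_differentiable F : smooth F -> forall x, differentiable F x.
Proof. by move=> sF x; have := sF [::] x. Qed.

Lemma smooth_pderiv F k : smooth F -> smooth (pderiv k F).
Proof. by move=> sF s x; have := sF (rcons s k) x; rewrite foldr_rcons. Qed.

Lemma rotation_point_derive p v a b (s t : R) k :
  is_derive t 1 (fun u => rotation_point p v a b s u 0 k)
    ((1 + s) * (cos t * a 0 k + sin t * b 0 k)).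
Proof.
have -> : (fun u => rotation_point p v a b s u 0 k) =
    (fun u => (p 0 k + (1 + s) * (v 0 k + b 0 k)) +
              ((1 + s) * a 0 k * sin u + - ((1 + s) * b 0 k) * cos u)).
  by apply/funext => u; rewrite !mxE; ring.
by apply: is_derive_eq; rewrite /GRing.scale /=; ring.
Qed.

(** [tau] carries the sign of [F] on the empty side. On the sphere [tau * F] is then nonnegative
    along the curve and vanishes at [t = 0], where the curve has velocity [a] and acceleration [b]:
    the first derivative is the gradient on [a], the second the Hessian on [a] plus the gradient on
    [b]. *)
Lemma sphere_rotation_test F p v a b (U : set E) (sg d s0 : R) :
  sg = 1 \/ sg = -1 -> v != 0 -> smooth F -> F (p + v) = 0 ->
  (forall t, enorm (v + sin t *: a + (1 - cos t) *: b) = enorm v) ->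
  (forall y, U y -> 0 < sg * (enorm (y - p) - enorm v) -> F y != 0) ->
  (forall s t, `|s| < d -> `|t| < d -> U (rotation_point p v a b s t)) ->
  d <= 1 -> 0 < s0 < d ->
  let tau := F (p + (1 + sg * s0) *: v) in
  [/\ tau != 0, tau * \sum_k pderiv k F (p + v) * a 0 k = 0 &
  0 <= tau * (\sum_k ((\sum_j pderiv j (pderiv k F) (p + v) * a 0 j) * a 0 k
                       + pderiv k F (p + v) * b 0 k))].
Proof.
move=> sgE v0 sF Fv0 rotN Fne0 hU d1 s0d tau.
have sg2 : sg * sg = 1 by case: sgE => ->; rewrite ?mulrNN mulr1.
have nsg : `|sg| = 1 by case: sgE => ->; rewrite ?normrN normr1.
pose H (s t : R) := F (rotation_point p v a b (sg * s) t).
have cF : continuous F.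
  by move=> x; apply: differentiable_continuous; exact: smooth_differentiable.
have cH1 s : continuous (H s).
  move=> t; apply: (@continuous_comp _ _ _ (rotation_point p v a b (sg * s))
    F _); last exact: cF.
  apply: cvgD; first exact: cvg_cst.
  apply: cvgZl_tmp; apply: cvgD; first apply: cvgD; first exact: cvg_cst.
    by apply: cvgZr_tmp; exact: continuous_sin.
  apply: cvgZr_tmp; apply: cvgB; first exact: cvg_cst.
  exact: continuous_cos.
have cH2 t : continuous (H ^~ t).
  move=> s; apply: (@continuous_comp _ _ _
    (fun s => rotation_point p v a b (sg * s) t) F _); last exact: cF.
  apply: cvgD; first exact: cvg_cst.
  apply: cvgZr_tmp; apply: cvgD; first exact: cvg_cst.
  by apply: cvgMl_tmp; exact: cvg_id.
have Hne0 s t : 0 < s < d -> `|t| < d -> H s t != 0.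
  move=> /andP[s0' sd] td; apply: Fne0.
    by apply: hU => //; rewrite normrM nsg mul1r gtr0_norm.
  rewrite /rotation_point (addrC p) addrK enormZ rotN.
  have sn : 0 < enorm v by rewrite enorm_gt0.
  (* [d <= 1] keeps the dilation factor positive when [sg] is -1. *)
  rewrite ger0_norm; last by case: sgE => ->; lra.
  rewrite mulrDl mul1r (addrC (enorm v)) addrK !mulrA sg2 mul1r.
  exact: mulr_gt0.
have H00 : H 0 0 = 0.
  rewrite /H /rotation_point mulr0 addr0 scale1r sin0 cos0 scale0r subrr scale0r.
  by rewrite !addr0.
have HE : H s0 0 = tau.
  by rewrite /H /rotation_point sin0 cos0 scale0r subrr scale0r !addr0.
have d0 : 0 < d by case/andP: s0d; exact: lt_trans.
pose g := rotation_point p v a b 0.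
have ge0 t : `|t| < d -> tau * F (g 0) <= tau * F (g t).
  have HtE u : H 0 u = F (g u) by rewrite /H mulr0.
  move=> td; rewrite -!HtE H00 mulr0 -HE.
  exact: (@nonvanishing_same_sign R H d).
have rp0 : g 0 = p + v.
  by rewrite /g /rotation_point addr0 scale1r sin0 cos0 scale0r subrr scale0r !addr0.
have dt (G : E -> R) (t : R) : smooth G -> is_derive t 1 (fun u => G (g u))
    (\sum_k pderiv k G (g t) *
      ((1 + 0) * (cos t * a 0 k + sin t * b 0 k))).
  move=> sG; apply: is_derive_curve; first exact: smooth_differentiable.
  by move=> k; exact: rotation_point_derive.
have [] := @second_derivative_test R (fun t => tau * F (g t))
  (fun t => tau * \sum_k pderiv k F (g t) *
     (cos t * a 0 k + sin t * b 0 k))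
  (tau * (\sum_k ((\sum_j pderiv j (pderiv k F) (p + v) * a 0 j) * a 0 k
                       + pderiv k F (p + v) * b 0 k))) d d0 _ _ ge0.
- move=> t.
  apply: (is_derive_eq (is_derive_mulr (is_derive_cst tau t 1) (dt F t sF))).
  rewrite mul0r add0r; congr (_ * _); apply: eq_bigr => k _.
  by rewrite addr0 mul1r.
- have dcs k : is_derive (0 : R) 1 (fun t => cos t * a 0 k + sin t * b 0 k)
      (b 0 k).
    apply: is_derive_eq.
    by rewrite sin0 cos0 /GRing.scale /=; ring.
  have dk k := is_derive_mulr (dt _ 0 (smooth_pderiv k sF)) (dcs k).
  apply: (is_derive_eq (is_derive_mulr (is_derive_cst tau (0 : R) 1)
    (@is_derive_sumr _ _ _ _ _ _ _ _ _ (fun k _ => dk k)))).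
  rewrite mul0r add0r /= rp0; congr (_ * _); apply: eq_bigr => k _.
  rewrite sin0 cos0 mul1r mul0r !addr0; congr (_ * _ + _).
  by apply: eq_bigr => j _; rewrite mul1r mul0r !addr0 mul1r.
rewrite /= rp0 sin0 cos0 => h1 h2; split => //.
  by rewrite -HE; apply: Hne0; rewrite ?normr0.
rewrite -[RHS]h1; congr (_ * _); apply: eq_bigr => k _.
by rewrite mul0r addr0 mul1r.
Qed.

Definition vec3 (x y z : R) : E := \row_k [:: x; y; z]`_k.

Lemma vec3E x y z :
  (vec3 x y z 0 i0 = x) * (vec3 x y z 0 i1 = y) * (vec3 x y z 0 i2 = z).
Proof. by rewrite /vec3 !mxE. Qed.

Lemma sum_vec3 (f : 'I_3 -> R) x y z :
  \sum_k f k * vec3 x y z 0 k = f i0 * x + f i1 * y + f i2 * z.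
Proof. by rewrite sum_I3 !vec3E. Qed.

(** The hypotheses are the coordinates of [u x f], with the zero entries left by [sum_vec3]; the
    conclusion is the identity [|u|^2 f = (f . u) u - u x (u x f)]. *)
Lemma cross_product_eq0 (f u : 'I_3 -> R) :
  f i0 * 0 + f i1 * - u i2 + f i2 * u i1 = 0 ->
  f i0 * u i2 + f i1 * 0 + f i2 * - u i0 = 0 ->
  f i0 * - u i1 + f i1 * u i0 + f i2 * 0 = 0 ->
  forall k, f k * (u i0 ^+ 2 + u i1 ^+ 2 + u i2 ^+ 2) =
            (f i0 * u i0 + f i1 * u i1 + f i2 * u i2) * u k.
Proof.
move=> T0 T1 T2; apply: forall_I3; apply/eqP; rewrite -subr_eq0; apply/eqP.
- transitivity (u i2 * (f i0 * u i2 + f i1 * 0 + f i2 * - u i0)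
    - u i1 * (f i0 * - u i1 + f i1 * u i0 + f i2 * 0)); first by ring.
  by rewrite T1 T2 !mulr0 subrr.
- transitivity (u i0 * (f i0 * - u i1 + f i1 * u i0 + f i2 * 0)
    - u i2 * (f i0 * 0 + f i1 * - u i2 + f i2 * u i1)); first by ring.
  by rewrite T0 T2 !mulr0 subrr.
- transitivity (u i1 * (f i0 * 0 + f i1 * - u i2 + f i2 * u i1)
    - u i0 * (f i0 * u i2 + f i1 * 0 + f i2 * - u i0)); first by ring.
  by rewrite T0 T1 !mulr0 subrr.
Qed.

(** Over the three axes [e], the tensors [(e x u) (e x u)^T] add up to [|u|^2 I - u u^T] and the
    vectors [e x (e x u)] to [- 2 u]. The sum of the tests is thus a tangential trace, obtained
    without choosing a tangent frame. *)
Lemma sum_rotation_tests (f : 'I_3 -> R) (h : 'I_3 -> 'I_3 -> R) (u : 'I_3 -> R) :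
  let Q a b := \sum_k ((\sum_j h k j * a 0 j) * a 0 k + f k * b 0 k) in
  Q (vec3 0 (- u i2) (u i1)) (vec3 0 (- u i1) (- u i2))
  + Q (vec3 (u i2) 0 (- u i0)) (vec3 (- u i0) 0 (- u i2))
  + Q (vec3 (- u i1) (u i0) 0) (vec3 (- u i0) (- u i1) 0) =
  (u i0 ^+ 2 + u i1 ^+ 2 + u i2 ^+ 2) * \sum_k h k k
  - \sum_k ((\sum_j h k j * u j) * u k) - 2 * \sum_k f k * u k.
Proof.
rewrite /=; under eq_bigr do rewrite sum_vec3.
under [X in _ + X + _]eq_bigr do rewrite sum_vec3.
under [X in _ + _ + X]eq_bigr do rewrite sum_vec3.
rewrite !sum_I3 !vec3E.
by ring.
Qed.

(* The curves [v + sin t *: a + (1 - cos t) *: b] below are the rotations of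
   [v] about the three coordinate axes. *)
Lemma touching_sphere F p v (U : set E) (sg : R) :
  sg = 1 \/ sg = -1 -> v != 0 -> smooth F -> nbhs (p + v) U ->
  F (p + v) = 0 -> (exists k, pderiv k F (p + v) != 0) ->
  (forall y, U y -> 0 < sg * (enorm (y - p) - enorm v) -> F y != 0) ->
  exists l : R, [/\ l != 0, forall k, pderiv k F (p + v) = l * v 0 k &
    0 <= sg * l * (enorm v ^+ 2 * \sum_k pderiv k (pderiv k F) (p + v)
      - \sum_k ((\sum_j pderiv j (pderiv k F) (p + v) * v 0 j) * v 0 k)
      - 2 * l * enorm v ^+ 2)].
Proof.
move=> sgE v0 sF Uv Fv0 [k0 Fk0] Fne0.
set x := v 0 i0; set y := v 0 i1; set z := v 0 i2.
pose a0 := vec3 0 (- z) y; pose b0 := vec3 0 (- y) (- z).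
pose a1 := vec3 z 0 (- x); pose b1 := vec3 (- x) 0 (- z).
pose a2 := vec3 (- y) x 0; pose b2 := vec3 (- x) (- y) 0.
have [d0 d00 h0] := rotation_point_near a0 b0 Uv.
have [d1 d10 h1] := rotation_point_near a1 b1 Uv.
have [d2 d20 h2] := rotation_point_near a2 b2 Uv.
pose d := Num.min (Num.min d0 d1) (Num.min d2 1).
have dpos : 0 < d by rewrite !lt_min d00 d10 d20 ltr01.
have [dd0 dd1 dd2 d1'] : [/\ d <= d0, d <= d1, d <= d2 & d <= 1].
  by rewrite /d !ge_min !lexx !orbT.
pose s0 := d / 2.
have s0d : 0 < s0 < d by rewrite /s0; apply/andP; split; lra.
have v2 : enorm v ^+ 2 = x ^+ 2 + y ^+ 2 + z ^+ 2 by rewrite sqr_enorm sum_I3.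
have rotE (a b : E) : (forall t, \sum_k (v + sin t *: a + (1 - cos t) *: b) 0 k ^+ 2 =
    enorm v ^+ 2) -> forall t, enorm (v + sin t *: a + (1 - cos t) *: b) = enorm v.
  by move=> h t; rewrite {1}/enorm h sqrtr_sqr ger0_norm ?enorm_ge0.
have test a b := @sphere_rotation_test F p v a b U sg d s0 sgE v0 sF Fv0.
have c2s2 t : cos t ^+ 2 + sin t ^+ 2 = 1 :> R by rewrite cos2sin2 subrK.
have [||tau0 T0 S0] := test a0 b0 _ Fne0 _ d1' s0d.
- apply: rotE => t; rewrite v2 sum_I3 /a0 /b0 !mxE /= -/x -/y -/z.
  transitivity (x ^+ 2 + (cos t ^+ 2 + sin t ^+ 2) * (y ^+ 2 + z ^+ 2)).
    by ring.
  by rewrite c2s2; ring.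
- by move=> s t hs ht; apply: h0; exact: lt_le_trans dd0.
have [||_ T1 S1] := test a1 b1 _ Fne0 _ d1' s0d.
- apply: rotE => t; rewrite v2 sum_I3 /a1 /b1 !mxE /= -/x -/y -/z.
  transitivity (y ^+ 2 + (cos t ^+ 2 + sin t ^+ 2) * (x ^+ 2 + z ^+ 2)).
    by ring.
  by rewrite c2s2; ring.
- by move=> s t hs ht; apply: h1; exact: lt_le_trans dd1.
have [||_ T2 S2] := test a2 b2 _ Fne0 _ d1' s0d.
- apply: rotE => t; rewrite v2 sum_I3 /a2 /b2 !mxE /= -/x -/y -/z.
  transitivity (z ^+ 2 + (cos t ^+ 2 + sin t ^+ 2) * (x ^+ 2 + y ^+ 2)).
    by ring.
  by rewrite c2s2; ring.
- by move=> s t hs ht; apply: h2; exact: lt_le_trans dd2.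
set tau := F _ in tau0 T0 S0 T1 S1 T2 S2.
(* The ray entering the empty side fixes the sign of the radial derivative: [F] starts at 0 there
   and has the sign of [tau]. *)
pose r (s : R) := F (p + (1 + sg * s) *: v).
have sg2 : sg * sg = 1 by case: sgE => ->; rewrite ?mulrNN mulr1.
have dr : is_derive (0 : R) 1 (fun s => tau * r s)
    (tau * (sg * \sum_k pderiv k F (p + v) * v 0 k)).
  have dc (s : R) k :
      is_derive s 1 (fun s : R => (p + (1 + sg * s) *: v) 0 k) (sg * v 0 k).
    have -> : (fun s : R => (p + (1 + sg * s) *: v) 0 k) =
       (fun s => (p 0 k + v 0 k) + (sg * v 0 k) * s).
      by apply/funext => u; rewrite !mxE; ring.
    by apply: is_derive_eq; rewrite /GRing.scale /=; ring.
  have c0E : p + (1 + sg * 0) *: v = p + v by rewrite mulr0 addr0 scale1r.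
  have := @is_derive_curve R F (fun s : R => p + (1 + sg * s) *: v) 0 _
    (smooth_differentiable sF _) (dc 0).
  move=> dF; apply: (is_derive_eq (is_derive_mulr (is_derive_cst tau (0 : R) 1) dF)).
  rewrite c0E mul0r add0r; congr (_ * _); rewrite mulr_sumr; apply: eq_bigr => k _.
  by rewrite mulrCA.
have r_ne0 s : 0 < s < d -> r s != 0.
  move=> /andP[sp sd]; apply: Fne0.
    have := h0 (sg * s) 0; rewrite /rotation_point sin0 cos0 scale0r subrr scale0r.
    rewrite !addr0; apply; last by rewrite normr0.
    rewrite normrM; suff -> : `|sg| = 1 by rewrite mul1r gtr0_norm // (lt_le_trans sd).
    by case: sgE => ->; rewrite ?normrN normr1.
  rewrite (addrC p) addrK enormZ ger0_norm; last by case: sgE => ->; lra.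
  rewrite mulrDl mul1r (addrC (enorm v)) addrK !mulrA sg2 mul1r.
  by rewrite mulr_gt0 // enorm_gt0.
have cr : continuous r.
  move=> s; apply: (@continuous_comp _ _ _ (fun s : R => p + (1 + sg * s) *: v) F _).
    apply: cvgD; first exact: cvg_cst.
    apply: cvgZr_tmp; apply: cvgD; first exact: cvg_cst.
    by apply: cvgMl_tmp; exact: cvg_id.
  by apply: differentiable_continuous; exact: smooth_differentiable.
have rp s : 0 < s < d -> 0 <= tau * r s.
  move=> /andP[sp sd]; have /andP[s0p s0lt] := s0d.
  rewrite leNgt -/(r s0); apply/negP => neg.
  have [ss|ss] := leP s0 s.
    have [c /andP[c1 c2] rc] := IVT_opposite_signs ss cr neg.
    suff /r_ne0 : 0 < c < d by rewrite rc eqxx.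
    by rewrite (lt_le_trans s0p c1) (le_lt_trans c2 sd).
  rewrite mulrC in neg.
  have [c /andP[c1 c2] rc] := IVT_opposite_signs (ltW ss) cr neg.
  suff /r_ne0 : 0 < c < d by rewrite rc eqxx.
  by rewrite (lt_le_trans sp c1) (le_lt_trans c2 s0lt).
have radial := is_derive_right_min dpos dr.
have {}radial : 0 <= tau * (sg * \sum_k pderiv k F (p + v) * v 0 k).
  by apply: radial => t td; rewrite {1}/r mulr0 addr0 scale1r Fv0 mulr0 rp.
have vpos : 0 < enorm v ^+ 2 by rewrite exprn_gt0 // enorm_gt0.
pose l := (\sum_k pderiv k F (p + v) * v 0 k) / enorm v ^+ 2.
have lE : \sum_k pderiv k F (p + v) * v 0 k = l * enorm v ^+ 2.
  by rewrite /l divfK // gt_eqF.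
set f := fun k => pderiv k F (p + v).
rewrite !sum_vec3 in T0 T1 T2.
(* After division by [tau] the three first-order conditions say that the gradient has zero cross
   product with [v]. *)
have {}T0 := mulIf tau0 (etrans (mulrC _ _) (etrans T0 (esym (mul0r tau)))).
have {}T1 := mulIf tau0 (etrans (mulrC _ _) (etrans T1 (esym (mul0r tau)))).
have {}T2 := mulIf tau0 (etrans (mulrC _ _) (etrans T2 (esym (mul0r tau)))).
have Fl k : pderiv k F (p + v) = l * v 0 k.
  apply: (mulIf (lt0r_neq0 vpos)).
  rewrite mulrAC -lE v2 sum_I3.
  exact: (@cross_product_eq0 f (fun k => v 0 k) T0 T1 T2).
exists l; split => //.
  by apply/eqP => l0; move: Fk0; rewrite Fl l0 mul0r eqxx.
set W := _ - _ - _.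
have SW : 0 <= tau * W.
  apply: le_trans (addr_ge0 (addr_ge0 S0 S1) S2) _.
  rewrite -!mulrDr /W -(mulrA 2) -lE v2.
  by rewrite (@sum_rotation_tests f _ (fun k => v 0 k)).
have lp : 0 <= tau * (sg * l).
  by move: radial; rewrite lE (mulrA sg) mulrA (pmulr_lge0 _ vpos).
(* The unknown sign of [tau] disappears in the product of the two inequalities, as [tau ^ 2]. *)
have : 0 <= (tau * (sg * l)) * (tau * W) by exact: mulr_ge0.
rewrite mulrACA pmulr_rge0 // -expr2 exprn_even_gt0 //=.
Qed.

End TouchingSphere.

(** * Mean curvature for a conformally flat metric *)

Section ConformalMetric.
Context {R : realType}.
Local Notation E := 'rV[R]_3.
Variable (f : E -> R).
Hypothesis f_gt0 : forall x, 0 < f x.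
Let g := fun x => (f x ^+ 2)%:M : 'M[R]_3.

Lemma gnorm_conformal x v : Defs.gnorm g x v = f x * enorm v.
Proof.
rewrite /Defs.gnorm /g mul_mx_scalar -scalemxAl mxE.
rewrite sqrtrM ?sqr_ge0 // sqrtr_sqr gtr0_norm //; congr (_ * Num.sqrt _).
by rewrite mxE; apply: eq_bigr => k _; rewrite mxE expr2.
Qed.

Lemma ggrad_conformal F x k : ggrad g F x 0 k = (f x ^+ 2)^-1 * pderiv k F x.
Proof.
rewrite mxE invmx_scalar (bigD1 k) //= mxE eqxx mulr1n big1 ?addr0 // => l lk.
by rewrite mxE eq_sym (negbTE lk) mulr0n mul0r.
Qed.

Lemma unit_normal_conformal F x k : unit_normal g F x 0 k =
  pderiv k F x * (f x * Num.sqrt (\sum_j pderiv j F x ^+ 2))^-1.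
Proof.
have fx := f_gt0 x.
rewrite /unit_normal.
have -> : ggrad g F x = (f x ^+ 2)^-1 *: \row_k pderiv k F x.
  by apply/rowP => j; rewrite ggrad_conformal !mxE.
rewrite gnorm_conformal enormZ gtr0_norm ?invr_gt0 ?exprn_gt0 // !mxE.
have -> : enorm (\row_k0 pderiv k0 F x) = Num.sqrt (\sum_j pderiv j F x ^+ 2).
  by congr Num.sqrt; apply: eq_bigr => j _; rewrite mxE.
set q := Num.sqrt _; rewrite !invfM; move: (q^-1) => qi.
by field; rewrite gt_eqF.
Qed.

(** These are the only symbols in the divergence of the normal. Two of the three derivatives of the
    metric cancel, and what is left is the derivative of [ln f]. *)
Lemma christoffel_conformal x i j (df : 'I_3 -> R) :
  (forall k, is_derive x (delta_mx 0 k) f (df k)) ->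
  christoffel g i i j x = df j / f x.
Proof.
move=> dfk.
have D k l m : pderiv k (fun y => g y l m) x = (2 * f x * df k) *+ (l == m).
  rewrite /pderiv; have [->|lm] := eqVneq l m.
    have -> : (fun y => g y m m) = (fun y => f y * f y).
      by apply/funext => y; rewrite mxE eqxx mulr1n expr2.
    by case: (is_derive_mulr (dfk k) (dfk k)) => _ ->; rewrite mulr1n; ring.
  have -> : (fun y => g y l m) = cst 0.
    by apply/funext => y; rewrite mxE (negbTE lm).
  by rewrite derive_cst.
have fx : f x != 0 by rewrite gt_eqF.
rewrite /christoffel (bigD1 i) //= big1 ?addr0 => [|l li]; last first.
  by rewrite invmx_scalar mxE eq_sym (negbTE li) mulr0n mul0r.
rewrite invmx_scalar mxE !D !eqxx !mulr1n (eq_sym j i) addrAC subrr add0r.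
by field.
Qed.

(** With [nu] the Euclidean unit normal, the mean curvature is [(div nu + 2 d_nu ln f) / f]: the
    Christoffel symbols contribute 3 times [d_nu ln f], and differentiating the factor [1 / f] of
    the unit normal takes one back. Since the gradient is [l v], [div nu] is expressed by the
    Laplacian and the Hessian on [v]. *)
Lemma mean_curvature_conformal (F : E -> R) (x v : E) (l : R) (df : 'I_3 -> R) :
  smooth F -> (forall k, is_derive x (delta_mx 0 k) f (df k)) ->
  l != 0 -> v != 0 -> (forall k, pderiv k F x = l * v 0 k) ->
  mean_curvature g F x = 0 ->
  enorm v ^+ 2 * \sum_k pderiv k (pderiv k F) x
  - \sum_k ((\sum_j pderiv j (pderiv k F) x * v 0 j) * v 0 k) =
  - (2 * l * enorm v ^+ 2 * ((\sum_k df k * v 0 k) / f x)).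
Proof.
move=> sF dfk l0 v0 Fl.
pose G k := pderiv k F; pose q z := \sum_j G j z ^+ 2.
have dG i k : is_derive x (delta_mx 0 i) (G k) (pderiv i (G k) x).
  apply: derivableP; apply: diff_derivable.
  by apply: smooth_differentiable; exact: smooth_pderiv.
have qE : q x = (`|l| * enorm v) ^+ 2.
  rewrite exprMn real_normK ?num_real // sqr_enorm mulr_sumr.
  by apply: eq_bigr => k _; rewrite /G Fl exprMn.
have w0 : 0 < `|l| * enorm v by rewrite mulr_gt0 ?normr_gt0 ?enorm_gt0.
have q0 : 0 < q x by rewrite qE exprn_gt0.
have sq : Num.sqrt (q x) = `|l| * enorm v.
  by rewrite qE sqrtr_sqr gtr0_norm.
have fx : f x != 0 by rewrite gt_eqF.
have dq i : is_derive x (delta_mx 0 i) q (2 * l * \sum_j pderiv i (G j) x * v 0 j).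
  have -> : q = fun z => \sum_j G j z * G j z.
    by apply/funext => z; apply: eq_bigr => j _; rewrite expr2.
  apply: (is_derive_eq (@is_derive_sumr _ _ _ _ _ _ _ _ _
     (fun j _ => is_derive_mulr (dG i j) (dG i j)))).
  rewrite mulr_sumr; apply: eq_bigr => j _; rewrite /G Fl; ring.
set w := `|l| * enorm v in qE w0 sq.
have dN i : pderiv i (fun z => unit_normal g F z 0 i) x =
    pderiv i (G i) x / (f x * w)
    - l * v 0 i * (df i * w + f x * (l * (\sum_j pderiv i (G j) x * v 0 j) / w))
        / (f x * w) ^+ 2.
  have -> : (fun z => unit_normal g F z 0 i) =
    (fun z => G i z * (f z * Num.sqrt (q z))^-1).
    by apply/funext => z; rewrite unit_normal_conformal.
  have m0 : f x * Num.sqrt (q x) != 0 by rewrite sq mulf_neq0 // gt_eqF.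
  have dm := is_derive_mulr (dfk i) (is_derive_sqrt q0 (dq i)).
  have := is_derive_mulr (dG i i) (@is_derive_invr _ _
    (fun z => f z * Num.sqrt (q z)) _ _ _ m0 dm).
  case=> _; rewrite /pderiv => ->; rewrite sq /G Fl; field.
  by rewrite fx gt_eqF.
rewrite /mean_curvature /covderiv big_split /=.
under eq_bigr do rewrite dN.
under [X in _ + X]eq_bigr => i _.
  under eq_bigr => j _ do
    rewrite (christoffel_conformal _ _ dfk) unit_normal_conformal -/(q x) sq Fl.
  over.
rewrite sumr_const card_ord big_split /= -mulr_suml.
set Lap := \sum_i pderiv i (G i) x.
set DV := \sum_k df k * v 0 k.
pose Q := \sum_i (\sum_j pderiv i (G j) x * v 0 j) * v 0 i.
have -> : \sum_k (\sum_j pderiv j (pderiv k F) x * v 0 j) * v 0 k = Q.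
  transitivity (\sum_k \sum_j pderiv j (G k) x * v 0 j * v 0 k).
    by apply: eq_bigr => k _; rewrite mulr_suml.
  rewrite exchange_big; apply: eq_bigr => i _; rewrite mulr_suml.
  by apply: eq_bigr => j _; exact: mulrAC.
have -> : \sum_(i < 3) - (l * v 0 i * (df i * w +
    f x * (l * (\sum_(j < 3) pderiv i (G j) x * v 0 j) / w)) / (f x * w) ^+ 2) =
    - (l * w * DV + f x * l * l / w * Q) / (f x * w) ^+ 2.
  rewrite sumrN -mulr_suml mulNr; congr (- (_ * _)).
  rewrite /DV /Q !mulr_sumr -big_split /=; apply: eq_bigr => i _.
  by move: (w^-1) => wi; ring.
have -> : \sum_(j < 3) df j / f x * (l * v 0 j / (f x * w)) =
    l / (f x * (f x * w)) * DV.
  rewrite /DV mulr_sumr; apply: eq_bigr => i _.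
  by rewrite (invfM (f x) (f x * w)); move: ((f x)^-1) ((f x * w)^-1) => c1 c2; ring.
have v2E : enorm v ^+ 2 = w ^+ 2 / l ^+ 2.
  by rewrite exprMn real_normK ?num_real // mulrC mulKf // expf_neq0.
rewrite v2E => H; apply/eqP; rewrite -subr_eq0; apply/eqP.
(* The difference of the two sides is the vanishing mean curvature times this factor. *)
rewrite -[RHS](mulr0 (f x * w * (w ^+ 2 / l ^+ 2))) -[in RHS]H.
by field; rewrite l0 fx gt_eqF.
Qed.

End ConformalMetric.

Section MinimalSurfaceTouching.
Context {R : realType}.
Local Notation E := 'rV[R]_3.

(** Up to a positive factor, [1 + (v . grad f) / f] is the mean curvature at [p + v] of the sphere
    about [p]. A minimal surface touching the sphere from inside ([sg = 1]) forces it to be at most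
    0, one touching from outside ([sg = -1]) at least 0. *)
Lemma minimal_surface_extremal_radius (f : E -> R) (M S : set E) (p v : E)
    (sg : R) (df : 'I_3 -> R) :
  (forall x, 0 < f x) ->
  closed_minimal_surface (fun x => (f x ^+ 2)%:M) M S ->
  sg = 1 \/ sg = -1 -> v != 0 -> S (p + v) ->
  (forall y, S y -> sg * (enorm (y - p) - enorm v) <= 0) ->
  (forall k, is_derive (p + v) (delta_mx 0 k) f (df k)) ->
  sg * (1 + (\sum_k df k * v 0 k) / f (p + v)) <= 0.
Proof.
move=> f0 [_ _ _ _ Sreg] sgE v0 Sv Sext dfk.
have [U [F [oU Uv sF SUE Freg]]] := Sreg _ Sv.
have [Fk0 mc0] := Freg _ (conj Sv Uv).
have Fv0 : F (p + v) = 0.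
  by have [+ _] : ([set y | F y = 0] `&` U) (p + v) by rewrite -SUE.
have [||l [l0 Fl]] := touching_sphere sgE v0 sF _ Fv0 Fk0 (U := U).
- exact: open_nbhs_nbhs.
- move=> y Uy; apply: contraPneq => Fy0; apply/negP; rewrite -leNgt.
  apply: Sext; have [//] : (S `&` U) y by rewrite SUE.
rewrite (mean_curvature_conformal f0 sF dfk l0 v0 Fl mc0).
set DV := _ / f _.
have vpos : 0 < l ^+ 2 * enorm v ^+ 2.
  by rewrite mulr_gt0 // exprn_even_gt0 //= ?enorm_eq0 // l0.
rewrite [leRHS](_ : _ = 2 * (l ^+ 2 * enorm v ^+ 2) * - (sg * (1 + DV))).
  by rewrite (pmulr_rge0 _ (mulr_gt0 (ltr0Sn R 1) vpos)) oppr_ge0.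
by ring.
Qed.

End MinimalSurfaceTouching.

(** * Derivatives of the potentials *)

Section Potential.
Context {R : realType}.
Local Notation E := 'rV[R]_3.
Variables (D : R) (n : nat) (a : box n -> R).
Hypothesis a_ge0 : forall i, 0 <= a i.

Lemma potential_ge1 x : 1 <= potential D a x.
Proof.
by rewrite lerDl sumr_ge0 // => i _; rewrite divr_ge0 ?enorm_ge0.
Qed.

Lemma potential_gt0 x : 0 < potential D a x.
Proof. exact: lt_le_trans (potential_ge1 x). Qed.

Lemma is_derive_enorm (x c : E) k : x != c ->
  is_derive x (delta_mx 0 k) (fun y => enorm (y - c)) ((x - c) 0 k / enorm (x - c)).
Proof.
move=> xc; have dc j :
    is_derive x (delta_mx 0 k) (fun y : E => (y - c) 0 j) ((k == j)%:R).
  have dl : differentiable (fun y : E => y 0 j) x by exact: differentiable_coord.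
  have -> : (fun y : E => (y - c) 0 j) = (fun y => y 0 j + - c 0 j).
    by apply/funext => y; rewrite !mxE.
  rewrite -[(k == j)%:R]addr0.
  apply: (is_derive_addr _ (is_derive_cst (- c 0 j) x _)).
  apply: DeriveDef; first exact: diff_derivable.
  have := @derive_mx R E 1 3 id x (delta_mx 0 k) (@derivable_id _ _ _ _).
  by rewrite derive_id => /rowP/(_ j); rewrite !mxE eqxx /= eq_sym => ->.
have xc0 : x - c != 0 by rewrite subr_eq0.
apply: (is_derive_eq (@is_derive_enorm_curve R E (fun y : E => y - c) x _ _ dc xc0)).
rewrite (bigD1 k) //= big1 ?addr0 => [|j jk]; first by rewrite eqxx mulr1.
by rewrite eq_sym (negbTE jk) mulr0.
Qed.

Definition dpotential (x : E) (k : 'I_3) : R :=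
  - \sum_i a i * ((x - Defs.center D i) 0 k / enorm (x - Defs.center D i) ^+ 3).

Lemma is_derive_potential (x : E) k :
  (forall i, a i != 0 -> x != Defs.center D i) ->
  is_derive x (delta_mx 0 k) (potential D a) (dpotential x k).
Proof.
move=> xc; rewrite -[dpotential _ _]add0r /dpotential -sumrN.
apply: (@is_derive_addr R E (cst 1)
  (fun x => \sum_i a i / enorm (x - Defs.center D i)) x _ 0).
apply: is_derive_sumr => i _; have [ai0|ai0] := eqVneq (a i) 0.
  under eq_fun do rewrite ai0 mul0r.
  by rewrite ai0 mul0r oppr0; exact: is_derive_cst.
have xi := xc _ ai0.
have e0 : enorm (x - Defs.center D i) != 0 by rewrite enorm_eq0 subr_eq0.
apply: (is_derive_eq (is_derive_mulr (is_derive_cst (a i) x _)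
  (@is_derive_invr R E (fun y => enorm (y - Defs.center D i)) x _ _ e0
    (is_derive_enorm k xi)))).
by rewrite /=; field.
Qed.

(** The pole at center [i] contributes exactly [- a i / |v|] and is kept exact, since it decides the
    neck radius; the other poles are estimated by Cauchy-Schwarz. *)
Lemma radial_dpotential (x : E) i : x != Defs.center D i ->
  `|\sum_k dpotential x k * (x - Defs.center D i) 0 k
     + a i / enorm (x - Defs.center D i)| <=
  enorm (x - Defs.center D i) * \sum_(j | j != i) a j / enorm (x - Defs.center D j) ^+ 2.
Proof.
move=> xi; set v := x - Defs.center D i.
have v0 : enorm v != 0 by rewrite enorm_eq0 subr_eq0.
pose T j := a j * ((\sum_k (x - Defs.center D j) 0 k * v 0 k) /
                     enorm (x - Defs.center D j) ^+ 3).
have -> : \sum_k dpotential x k * v 0 k = - \sum_j T j.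
  rewrite /dpotential; under eq_bigr do rewrite mulNr mulr_suml.
  rewrite sumrN exchange_big /=; congr (- _); apply: eq_bigr => j _.
  rewrite /T mulr_suml mulr_sumr; apply: eq_bigr => k _.
  by rewrite -!mulrA; congr (_ * (_ * _)); rewrite mulrC.
rewrite (bigD1 i) //= opprD.
have -> : T i = a i / enorm v.
  rewrite /T -/v (eq_bigr (fun k => v 0 k ^+ 2)) => [|k _]; last by rewrite expr2.
  by rewrite -sqr_enorm; field.
rewrite addrAC addNr add0r normrN mulr_sumr.
apply: le_trans (ler_norm_sum _ _ _) _; apply: ler_sum => j _.
rewrite /T normrM ger0_norm // [leRHS]mulrCA ler_wpM2l //.
(* At the center of box [j] both quotients are 0, by the convention for the inverse of 0. *)
have [e0|e0] := eqVneq (enorm (x - Defs.center D j)) 0.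
  by rewrite e0 !expr0n /= invr0 !mulr0 normr0.
rewrite normrM normfV normrX (ger0_norm (enorm_ge0 _)).
have ep : 0 < enorm (x - Defs.center D j) by rewrite lt_def e0 enorm_ge0.
rewrite ler_pdivrMr ?exprn_gt0 // [leRHS](_ : _ = enorm (x - Defs.center D j) * enorm v).
  exact: norm_dot_le.
by field.
Qed.

End Potential.

(** * Sign of the mean curvature of small spheres *)

Section NeckArithmetic.
Context {R : realType}.

(** [H] and [K] are the backgrounds of the two potentials, [a] and [b] the near fields [mass / r],
    [e1] and [e2] the radial errors. Clearing denominators cancels all terms linear in [a] and [b].
    As [a] and [b] may be large, their products with the errors need separate bounds;
    [H + K <= H K + 1] absorbs the rest. *)
Lemma neck_arithmetic_expand (H K a b e1 e2 : R) : 1 <= H -> 1 <= K ->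
  0 <= a -> 0 <= b -> `|e1| <= 8^-1 -> `|e2| <= 8^-1 ->
  `|e1| * b <= 8^-1 -> `|e2| * a <= 8^-1 ->
  let s := 1 + ((- a + e1) / (H + a) + (- b + e2) / (K + b)) in
  exists r : R, [/\ 0 < (H + a) * (K + b),
    (H + a) * (K + b) * s = H * K - a * b + r, `|r| <= 3 / 8 + H * K / 8 &
    1 <= H * K].
Proof.
move=> H1 K1 a0 b0 h1 h2 h3 h4.
have Ha : 0 < H + a by lra.
have Kb : 0 < K + b by lra.
exists (e1 * K + e2 * H + e1 * b + e2 * a); split.
- exact: mulr_gt0.
- by field; rewrite !gt_eqF.
- have HK : H + K <= H * K + 1.
    have : 0 <= (H - 1) * (K - 1) by rewrite mulr_ge0 // subr_ge0.
    by lra.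
  have f1 : `|e1 * K| <= 8^-1 * K.
    by rewrite normrM (ger0_norm (le_trans ler01 K1)) ler_wpM2r // (le_trans ler01).
  have f2 : `|e2 * H| <= 8^-1 * H.
    by rewrite normrM (ger0_norm (le_trans ler01 H1)) ler_wpM2r // (le_trans ler01).
  have f3 : `|e1 * b| <= 8^-1 by rewrite normrM (ger0_norm b0).
  have f4 : `|e2 * a| <= 8^-1 by rewrite normrM (ger0_norm a0).
  have g1 := ler_normD (e1 * K + e2 * H + e1 * b) (e2 * a).
  have g2 := ler_normD (e1 * K + e2 * H) (e1 * b).
  have g3 := ler_normD (e1 * K) (e2 * H).
  lra.
- by rewrite -[leLHS]mulr1 ler_pM.
Qed.

(** With errors below [1 / 8], [a b >= 7 / 8 H K - 3 / 8 >= 1 / 2]. *)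
Lemma neck_arithmetic_max (H K a b e1 e2 : R) : 1 <= H -> 1 <= K ->
  0 <= a -> 0 <= b -> `|e1| <= 8^-1 -> `|e2| <= 8^-1 ->
  `|e1| * b <= 8^-1 -> `|e2| * a <= 8^-1 ->
  1 + ((- a + e1) / (H + a) + (- b + e2) / (K + b)) <= 0 -> 1 <= 2 * (a * b).
Proof.
move=> H1 K1 a0 b0 h1 h2 h3 h4 s0.
have [r [p0 sE]] := neck_arithmetic_expand H1 K1 a0 b0 h1 h2 h3 h4.
rewrite -(pmulr_rle0 _ p0) sE in s0.
by rewrite ler_norml => /andP[r1 r2] HK; lra.
Qed.

Lemma neck_arithmetic_min (H K a b e1 e2 : R) : 1 <= H -> 1 <= K ->
  0 <= a -> 0 <= b -> `|e1| <= 8^-1 -> `|e2| <= 8^-1 ->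
  `|e1| * b <= 8^-1 -> `|e2| * a <= 8^-1 ->
  0 <= 1 + ((- a + e1) / (H + a) + (- b + e2) / (K + b)) ->
  a * b <= 2 * (H * K).
Proof.
move=> H1 K1 a0 b0 h1 h2 h3 h4 s0.
have [r [p0 sE]] := neck_arithmetic_expand H1 K1 a0 b0 h1 h2 h3 h4.
rewrite -(pmulr_rge0 _ p0) sE in s0.
by rewrite ler_norml => /andP[r1 r2] HK; lra.
Qed.

End NeckArithmetic.

(** * Bounds for the potentials *)

Section LatticeSum.
Context {R : realType}.

Lemma count_lattice_points (N : nat) (lo hi : R) : lo <= hi + 1 ->
  \sum_(b < N) (lo <= b%:R <= hi)%R%:R <= hi + 1 - lo.
Proof.
move=> lohi.
(* Strengthened for the induction: the interval is cut at [N], and the maximum with 0 covers the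
   stages at which [N] has not reached [lo]. *)
suff H : \sum_(b < N) (lo <= b%:R <= hi)%R%:R <=
    Num.max 0 (Num.min N%:R (hi + 1) - lo).
  apply: le_trans H _; rewrite ge_max subr_ge0 lohi /= lerD2r.
  by rewrite ge_min lexx orbT.
elim: N => [|N ih]; first by rewrite big_ord0 le_max lexx.
rewrite big_ord_recr /=; have [/andP[h1 h2]|] := boolP (lo <= N%:R <= hi).
  have e1 : Num.min N%:R (hi + 1) = N%:R :> R by apply/min_idPl; lra.
  have e2 : Num.min N.+1%:R (hi + 1) = N.+1%:R :> R.
    by apply/min_idPl; rewrite -natr1 lerD2r.
  rewrite e1 in ih; rewrite e2 le_max -natr1; apply/orP; right.
  have e3 : Num.max 0 (N%:R - lo) = N%:R - lo by apply/max_idPr; rewrite subr_ge0.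
  by rewrite e3 in ih; rewrite /=; lra.
move=> _; rewrite addr0; apply: le_trans ih _.
rewrite ge_max !le_max lexx /=; apply/orP; right; rewrite lerD2r.
by rewrite le_min !ge_min lexx orbT andbT ler_nat leqnSn.
Qed.

Lemma count_lattice_ball (N : nat) (t d : R) : 0 <= d ->
  \sum_(b < N) (`|t - b%:R| <= d)%R%:R <= 2 * d + 1.
Proof.
move=> d0; have h : t - d <= t + d + 1 by lra.
have <- : t + d + 1 - (t - d) = 2 * d + 1 by ring.
apply: le_trans (count_lattice_points N h).
rewrite le_eqVlt; apply/orP; left; apply/eqP; apply: eq_bigr => b _.
congr (nat_of_bool _)%:R; rewrite ler_norml.
apply/idP/idP => /andP[h1 h2]; apply/andP; split; lra.
Qed.

(* Each lattice point is charged to the coordinate [k] in which it is farthest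
   from [t]; at distance [d] in that coordinate there are at most
   [(2 d + 1) ^ 2] such points. *)
Lemma lattice_inverse_square_sum (N : nat) (t : 'I_3 -> R)
    (P : pred {ffun 'I_3 -> 'I_N}) :
  (forall j, P j -> exists k, 2^-1 <= `|t k - (j k)%:R|) ->
  \sum_(j | P j) (\sum_k (t k - (j k)%:R) ^+ 2)^-1 <= 48 * N%:R.
Proof.
move=> hP.
pose c (k : 'I_3) (a : 'I_N) : R :=
  if 2^-1 <= `|t k - a%:R| then (`|t k - a%:R| ^+ 2)^-1 else 0.
pose e (k l : 'I_3) (a b : 'I_N) : R :=
  if l == k then (b == a)%:R else (`|t l - b%:R| <= `|t k - a%:R|)%R%:R.
(* The charge is a sum over the possible values [a] of [j k] of a product over coordinates, so that
   the sum over all [j] factors coordinate by coordinate. *)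
pose w (k : 'I_3) (j : {ffun 'I_3 -> 'I_N}) := \sum_a c k a * \prod_l e k l a (j l).
have c0 k a : 0 <= c k a by rewrite /c; case: ifP => // _; rewrite invr_ge0 exprn_ge0.
have e0 k l a b : 0 <= e k l a b by rewrite /e; case: ifP.
have w0 k j : 0 <= w k j.
  by apply: sumr_ge0 => a _; rewrite mulr_ge0 // prodr_ge0.
have wle (j : {ffun 'I_3 -> 'I_N}) : P j ->
    (\sum_k (t k - (j k)%:R) ^+ 2)^-1 <= \sum_k w k j.
  move=> /hP [k1 hk1].
  have [k _ kmax] := @Order.TotalTheory.arg_maxP _ _ _ k1 xpredT
     (fun k => `|t k - (j k)%:R|) isT.
  have {}kmax l : `|t l - (j l)%:R| <= `|t k - (j k)%:R| by exact: kmax.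
  have dk : 2^-1 <= `|t k - (j k)%:R| by apply: le_trans hk1 _; exact: kmax.
  apply: (@le_trans _ _ (w k j)); last first.
    by rewrite [leRHS](bigD1 k) //= lerDl sumr_ge0.
  rewrite /w (bigD1 (j k)) //= [X in _ * X]big1 => [|l _]; last first.
    by rewrite /e; case: eqVneq => [->|_]; rewrite ?eqxx // kmax.
  have ck : c k (j k) = (`|t k - (j k)%:R| ^+ 2)^-1 by rewrite /c dk.
  rewrite mulr1 ck; apply: (@le_trans _ _ (`|t k - (j k)%:R| ^+ 2)^-1).
    have p0 : 0 < `|t k - (j k)%:R| ^+ 2 by rewrite exprn_gt0 // (lt_le_trans _ dk).
    rewrite lef_pV2 ?posrE //.
      rewrite real_normK ?num_real // (bigD1 k) //= lerDl sumr_ge0 // => l _.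
      exact: sqr_ge0.
    apply: lt_le_trans p0 _; rewrite real_normK ?num_real //.
    by rewrite (bigD1 k) //= lerDl sumr_ge0 // => l _; exact: sqr_ge0.
  by rewrite lerDl sumr_ge0 // => a _; rewrite mulr_ge0 // prodr_ge0.
apply: le_trans (ler_sum _ wle) _.
apply: (@le_trans _ _ (\sum_j \sum_k w k j)).
  rewrite [leRHS](bigID P) /= lerDl; apply: sumr_ge0 => j _.
  exact: sumr_ge0.
rewrite exchange_big /=.
suff wk k : \sum_j w k j <= 16 * N%:R.
  apply: (@le_trans _ _ (\sum_(k < 3) 16 * N%:R)); first by apply: ler_sum.
  by rewrite sumr_const card_ord; lra.
rewrite /w exchange_big /=.
apply: (@le_trans _ _ (\sum_(a < N) 16)); last first.
  by rewrite sumr_const card_ord mulr_natr.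
apply: ler_sum => a _; rewrite -mulr_sumr -(bigA_distr_bigA (fun l b => e k l a b)).
rewrite /c; case: ifP => [dk|_]; last by rewrite mul0r.
set d := `|_| in dk *.
have d0 : 0 < d by rewrite (lt_le_trans _ dk).
rewrite (bigD1 k) //= [X in _ * (X * _)](_ : _ = 1) ?mul1r; last first.
  rewrite /e (bigD1 a) //= !eqxx big1 ?addr0 // => b /negbTE ba.
  by rewrite ba.
apply: (@le_trans _ _ ((d ^+ 2)^-1 * (2 * d + 1) ^+ 2)).
  rewrite ler_wpM2l ?invr_ge0 ?exprn_ge0 ?(ltW d0) //.
  apply: (@le_trans _ _ (\prod_(l < 3 | l != k) (2 * d + 1))).
    apply: ler_prod => l lk; rewrite sumr_ge0 //= /e (negbTE lk).
    exact/count_lattice_ball/ltW.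
  rewrite prodr_const; suff -> : #|[pred l | l != k]| = 2%N by [].
  by have := cardC1 k; rewrite card_ord.
rewrite mulrC -expr_div_n.
(* This uses [d >= 1 / 2]. Each of the [N] values of a coordinate then costs at most [4 ^ 2], and
   the three coordinates give [48 N]. *)
have : (2 * d + 1) / d <= 4 by rewrite ler_pdivrMr //; lra.
move=> h; apply: le_trans (_ : 4 ^+ 2 <= _); last by lra.
by rewrite ler_pXn2r ?nnegrE ?divr_ge0 //; lra.
Qed.

End LatticeSum.

Section PotentialBounds.
Context {R : realType}.
Local Notation E := 'rV[R]_3.
Variables (D s : R) (n : nat) (a : box n -> R).
Hypotheses (D_gt0 : 0 < D) (n_gt0 : (0 < n)%N).
Hypotheses (a_ge0 : forall i, 0 <= a i) (s_ge0 : 0 <= s).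
Hypothesis a_le : forall i, a i <= s * D / n%:R ^+ 3.

Let nR_gt0 : 0 < n%:R :> R. Proof. by rewrite ltr0n. Qed.

(** [x] is outside the open box [j]. The condition is on one coordinate because the lattice count
    needs a coordinate at least half a side away. *)
Definition off_center (x : E) (j : box n) :=
  exists k, D / (2 * n%:R) <= `|(x - Defs.center D j) 0 k|.

Lemma off_center_enorm x j : off_center x j ->
  D / (2 * n%:R) <= enorm (x - Defs.center D j).
Proof. by move=> [k] /le_trans; apply; exact: coord_le_enorm. Qed.

Lemma sum_inverse_square_distance x (P : pred (box n)) :
  (forall j, P j -> off_center x j) ->
  \sum_(j | P j) (enorm (x - Defs.center D j) ^+ 2)^-1
    <= 96 * n%:R ^+ 3 / D ^+ 2.
Proof.
(* In units of the side [D / n], and after this shift, the centers are the integer points with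
   coordinates below [2 n]; hence [96 = 48 * 2]. *)
move=> hP; pose t k := (x 0 k + D) * n%:R / D - 2^-1.
have n0 : n%:R != 0 :> R by rewrite gt_eqF.
have D0 : D != 0 by rewrite gt_eqF.
have tE (j : box n) k : (x - Defs.center D j) 0 k = D / n%:R * (t k - (j k)%:R).
  by rewrite !mxE /t; field; rewrite n0 D0.
have tP j : P j -> exists k, 2^-1 <= `|t k - (j k)%:R|.
  move=> /hP[k]; rewrite tE normrM gtr0_norm ?divr_gt0 // => h; exists k.
  rewrite -(ler_pM2l (divr_gt0 D_gt0 nR_gt0)); apply: le_trans h.
  by rewrite invfM mulrA mulrAC.
rewrite (eq_bigr (fun j : box n => n%:R ^+ 2 / D ^+ 2 *
    (\sum_k (t k - (j k)%:R) ^+ 2)^-1)) => [|j _]; last first.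
  rewrite sqr_enorm; under eq_bigr do rewrite tE exprMn.
  by rewrite -mulr_sumr invfM; congr (_ * _); field; rewrite n0 D0.
rewrite -mulr_sumr.
have := lattice_inverse_square_sum tP; rewrite natrM => h.
have c0 : 0 <= n%:R ^+ 2 / D ^+ 2 by rewrite divr_ge0 ?exprn_ge0 ?ltW.
apply: le_trans (ler_wpM2l c0 h) _.
by rewrite le_eqVlt; apply/orP; left; apply/eqP; field.
Qed.

Lemma sum_potential2_le x (P : pred (box n)) :
  (forall j, P j -> off_center x j) ->
  \sum_(j | P j) a j / enorm (x - Defs.center D j) ^+ 2 <= 96 * s / D.
Proof.
move=> hP.
apply: (@le_trans _ _ (s * D / n%:R ^+ 3 *
    \sum_(j | P j) (enorm (x - Defs.center D j) ^+ 2)^-1)).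
  rewrite mulr_sumr; apply: ler_sum => j _.
  by rewrite ler_wpM2r // invr_ge0 exprn_ge0 // enorm_ge0.
have c0 : 0 <= s * D / n%:R ^+ 3.
  by rewrite divr_ge0 ?exprn_ge0 ?mulr_ge0 // ltW.
apply: le_trans (ler_wpM2l c0 (sum_inverse_square_distance hP)) _.
rewrite le_eqVlt; apply/orP; left; apply/eqP; field.
by rewrite !gt_eqF.
Qed.

(* [1 / d <= 1 / D + D / d ^ 2] reduces the potential to the inverse-square
   sum, at the price of the total mass. *)
Lemma sum_potential1_le x (P : pred (box n)) :
  (forall j, P j -> off_center x j) ->
  \sum_(j | P j) a j / enorm (x - Defs.center D j) <= 104 * s.
Proof.
move=> hP.
apply: (@le_trans _ _ (\sum_(j : box n) s / n%:R ^+ 3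
   + D * \sum_(j | P j) a j / enorm (x - Defs.center D j) ^+ 2)).
  rewrite mulr_sumr; apply: (@le_trans _ _ (\sum_(j | P j) s / n%:R ^+ 3
    + \sum_(j | P j) D * (a j / enorm (x - Defs.center D j) ^+ 2))).
    rewrite -big_split /=; apply: ler_sum => j Pj.
    have d0 : 0 < enorm (x - Defs.center D j).
      by apply: lt_le_trans (off_center_enorm (hP _ Pj)); rewrite divr_gt0 ?mulr_gt0.
    set d := enorm _ in d0 *.
    apply: (@le_trans _ _ (a j * (D^-1 + D / d ^+ 2))).
      rewrite ler_wpM2l //.
      have [Dd|dD] := leP D d.
        have : d^-1 <= D^-1 by rewrite lef_pV2.
        by move=> /le_trans; apply; rewrite lerDl divr_ge0 ?exprn_ge0 ?ltW.
      apply: (@le_trans _ _ (D / d ^+ 2)); last by rewrite lerDr invr_ge0 ltW.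
      by rewrite ler_pdivlMr ?exprn_gt0 // expr2 mulrA mulVf ?gt_eqF // mul1r ltW.
    rewrite mulrDr lerD //; last by rewrite mulrCA.
    rewrite ler_pdivrMr // (le_trans (a_le j)) //.
    by rewrite mulrAC.
  rewrite lerD2r [leRHS](bigID P) /= lerDl sumr_ge0 // => j _.
  by rewrite divr_ge0 // exprn_ge0 // ltW.
have h := ler_wpM2l (ltW D_gt0) (sum_potential2_le hP).
rewrite sumr_const card_ffun !card_ord.
apply: le_trans (lerD (lexx _) h) _.
rewrite le_eqVlt; apply/orP; left; apply/eqP.
(* The [(2 n) ^ 3] boxes contribute [8 s]; with the [96 s] of the inverse-square sum this makes
   [104 s]. *)
rewrite [X in X + _](_ : _ = 8 * s).
  by field; rewrite gt_eqF.
by rewrite -[LHS]mulr_natr natrX natrM; field; rewrite gt_eqF.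
Qed.

Lemma potential_le_off_center x : (forall j, off_center x j) ->
  potential D a x <= 1 + 104 * s.
Proof.
by move=> h; rewrite /potential lerD2l; exact: (@sum_potential1_le x xpredT).
Qed.

End PotentialBounds.

Lemma continuous_enormB {R : realType} (p : 'rV[R]_3) :
  continuous (fun y : 'rV[R]_3 => enorm (y - p)).
Proof.
move=> y; have c : {for y, continuous (fun y : 'rV[R]_3 => y - p)}.
  apply: (@continuousB R _ _ id (cst p) y); [exact: cvg_id | exact: cst_continuous].
apply: (@continuous_comp _ _ _ (fun y : 'rV[R]_3 => y - p) (@enorm R) y c).
exact: enorm_continuous.
Qed.

(** * Radius of the necks *)

Section NeckRadius.
Context {R : realType}.
Local Notation E := 'rV[R]_3.
Variables (D s : R) (n : nat).
Hypotheses (D_gt0 : 0 < D) (n_gt0 : (0 < n)%N).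

Let nR_gt0 : 0 < n%:R :> R. Proof. by rewrite ltr0n. Qed.

Lemma center_separated_coord (i j : box n) k : i k != j k ->
  D / n%:R <= `|(Defs.center D i - Defs.center D j) 0 k|.
Proof.
move=> ijk; rewrite !mxE.
rewrite (_ : _ - _ = ((i k)%:R - (j k)%:R) * (D / n%:R)); last by ring.
rewrite normrM (gtr0_norm (divr_gt0 D_gt0 nR_gt0)) -[leLHS]mul1r.
rewrite ler_wpM2r ?divr_ge0 ?(ltW D_gt0) //.
have : (i k : nat) != j k by apply: contra ijk => /eqP h; apply/eqP/val_inj.
rewrite neq_ltn => /orP[h|h].
  by rewrite distrC -(natrB _ (ltnW h)) ger0_norm // ler1n subn_gt0.
by rewrite -(natrB _ (ltnW h)) ger0_norm // ler1n subn_gt0.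
Qed.

Lemma center_separated (i j : box n) : i != j ->
  exists k, D / n%:R <= `|(Defs.center D i - Defs.center D j) 0 k|.
Proof.
move=> ij; have [k ijk] : exists k, i k != j k.
  apply/existsP; rewrite -negb_forall; apply: contra ij => /forallP h.
  by apply/eqP/ffunP => k; apply/eqP; exact: h.
by exists k; exact: center_separated_coord.
Qed.

Lemma center_inj : injective (@Defs.center R D n).
Proof.
move=> i j ij; apply/eqP/negPn/negP => /center_separated[k].
by rewrite ij subrr mxE normr0 leNgt divr_gt0.
Qed.

Lemma off_center_other (x : E) (i j : box n) :
  (forall k, `|(x - Defs.center D i) 0 k| <= D / (2 * n%:R)) -> j != i ->
  off_center D x j.
Proof.
move=> xi; rewrite eq_sym => /center_separated[k ck]; exists k; move: (xi k) ck.
rewrite !mxE; set c := - D + _; set c' := - D + _.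
have -> : D / n%:R = D / (2 * n%:R) + D / (2 * n%:R).
  by field; rewrite gt_eqF.
set d := D / _ => h1 h2.
have : `|c - c'| <= `|x 0 k - c'| + `|x 0 k - c|.
  rewrite (distrC (x 0 k) c); apply: le_trans (ler_normD _ _).
  by rewrite le_eqVlt; apply/orP; left; apply/eqP; congr (`|_|); ring.
lra.
Qed.

Variables (al be : box n -> R).
Hypotheses (al_ge0 : forall i, 0 <= al i) (be_ge0 : forall i, 0 <= be i).
Hypothesis s_ge0 : 0 <= s.
Hypothesis al_le : forall i, al i <= s * D / n%:R ^+ 3.
Hypothesis be_le : forall i, be i <= s * D / n%:R ^+ 3.
Hypothesis n_large : 1000 * (1 + s) <= n%:R.

Let f (x : E) := potential D al x * potential D be x.

Lemma weight_ge1 x : 1 <= f x.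
Proof. by rewrite -[leLHS]mulr1 ler_pM ?potential_ge1. Qed.

Lemma weight_gt0 x : 0 < f x.
Proof. exact: lt_le_trans (weight_ge1 x). Qed.

Lemma mass_sqr_le : 1000 * s ^+ 2 <= n%:R ^+ 3.
Proof.
have n1 : 1 <= n%:R :> R by rewrite ler1n.
have ns : 1000 * s <= n%:R by move: n_large; lra.
have s0 : 0 <= 1000 * s by move: s_ge0; lra.
have sn : s <= n%:R by move: s_ge0 ns; lra.
rewrite (_ : 1000 * s ^+ 2 = 1000 * s * s); last by ring.
apply: le_trans (ler_pM s0 s_ge0 ns sn) _.
by rewrite exprSr -expr2 -[leLHS]mulr1 ler_wpM2l ?sqr_ge0.
Qed.

Section Term.
Variables (a b : box n -> R) (i : box n) (x : E).
Hypotheses (a_ge0 : forall i, 0 <= a i) (b_ge0 : forall i, 0 <= b i).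
Hypothesis a_le : forall i, a i <= s * D / n%:R ^+ 3.
Hypothesis b_le : forall i, b i <= s * D / n%:R ^+ 3.
Let v := x - Defs.center D i.
Hypotheses (v_neq0 : v != 0) (v_le : enorm v <= D / (2 * n%:R)).

Let v_gt0 : 0 < enorm v. Proof. by rewrite enorm_gt0. Qed.

Lemma off_center_neighbour j : j != i -> off_center D x j.
Proof.
apply: off_center_other => k; apply: le_trans v_le; exact: coord_le_enorm.
Qed.

Definition background := 1 + \sum_(j | j != i) a j / enorm (x - Defs.center D j).

Lemma potential_background : potential D a x = background + a i / enorm v.
Proof. by rewrite /potential (bigD1 i) //= addrCA addrC. Qed.

Lemma background_ge1 : 1 <= background.
Proof. by rewrite lerDl sumr_ge0 // => j _; rewrite divr_ge0 ?enorm_ge0. Qed.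

Lemma background_le : background <= 1 + 104 * s.
Proof.
by rewrite lerD2l; apply: sum_potential1_le => // j; exact: off_center_neighbour.
Qed.

Let e := \sum_k dpotential D a x k * v 0 k + a i / enorm v.

Lemma radial_error : `|e| <= enorm v * (96 * s / D).
Proof.
apply: le_trans (radial_dpotential _ _) _ => //; first by rewrite -subr_eq0.
rewrite ler_wpM2l ?enorm_ge0 //.
by apply: sum_potential2_le => // j; exact: off_center_neighbour.
Qed.

Lemma radial_error_small : `|e| <= 8^-1.
Proof.
apply: le_trans radial_error _.
apply: (@le_trans _ _ (D / (2 * n%:R) * (96 * s / D))).
  by rewrite ler_wpM2r // divr_ge0 ?mulr_ge0 // ltW.
rewrite (_ : _ * _ = 48 * s / n%:R); last by field; rewrite !gt_eqF.
by rewrite ler_pdivrMr //; move: n_large s_ge0; lra.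
Qed.

(** The near field [b i / |v|] is unbounded, but the radial error is proportional to [|v|], which
    cancels. *)
Lemma radial_error_other : `|e| * (b i / enorm v) <= 8^-1.
Proof.
apply: (@le_trans _ _ (enorm v * (96 * s / D) * (b i / enorm v))).
  by rewrite ler_wpM2r ?radial_error // divr_ge0 ?enorm_ge0.
rewrite (_ : _ * _ = 96 * s / D * b i); last by field; rewrite !gt_eqF.
apply: (@le_trans _ _ (96 * s / D * (s * D / n%:R ^+ 3))).
  by rewrite ler_wpM2l // divr_ge0 ?mulr_ge0 // ltW.
rewrite (_ : _ * _ = 96 * s ^+ 2 / n%:R ^+ 3); last by field; rewrite !gt_eqF.
rewrite ler_pdivrMr ?exprn_gt0 //.
by have := mass_sqr_le; have := sqr_ge0 s; lra.
Qed.

End Term.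

(** At the farthest point only the lower bound 1 for the backgrounds enters; at the nearest point
    their upper bound [1 + 104 s] does, hence the asymmetry of the constants. *)
Lemma neck_radius (i : box n) (S : set E) : al i * be i != 0 ->
  neck_surface D al be i S -> forall y, S y ->
  al i * be i / (2 * (1 + 104 * s) ^+ 2) <= enorm (y - Defs.center D i) ^+ 2
    <= 2 * (al i * be i).
Proof.
move=> ab0 [Smin Sball _]; set p := Defs.center D i.
have [Sne Sc _ SM _] := Smin.
have cdist : {within S, continuous (fun y : E => enorm (y - p))}.
  exact/continuous_subspaceT/continuous_enormB.
have Pp : Pstar D al be p.
  exists i => //=; apply: contra ab0; rewrite paddr_eq0 // => /andP[/eqP -> _].
  by rewrite mul0r.
(* [sg = 1] at the farthest and [sg = -1] at the nearest point of the neck. *)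
have key x sg : S x -> sg = 1 \/ sg = -1 ->
    (forall y, S y -> sg * (enorm (y - p) - enorm (x - p)) <= 0) ->
    [/\ 0 < enorm (x - p), enorm (x - p) <= D / (2 * n%:R) & sg *
    (1 + ((- (al i / enorm (x - p)) +
             (\sum_k dpotential D al x k * (x - p) 0 k + al i / enorm (x - p))) /
            (background al i x + al i / enorm (x - p))
        + (- (be i / enorm (x - p)) +
             (\sum_k dpotential D be x k * (x - p) 0 k + be i / enorm (x - p))) /
            (background be i x + be i / enorm (x - p)))) <= 0].
  move=> Sx sgE ext.
  have v0 : x - p != 0.
    by rewrite subr_eq0; apply/eqP => xp; have := SM _ Sx; rewrite xp.
  have xP (a : box n -> R) : (forall j, a j != 0 -> al j + be j != 0) ->
      forall j, a j != 0 -> x != Defs.center D j.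
    move=> h j /h abj; apply/eqP => xj; have := SM _ Sx; rewrite xj; apply.
    by exists j.
  split; first by rewrite enorm_gt0.
    exact: Sball.
  have dal k : is_derive x (delta_mx 0 k) (potential D al) (dpotential D al x k).
    apply: is_derive_potential => j; apply: (xP al) => l; apply: contra.
    by rewrite paddr_eq0 // => /andP[].
  have dbe k : is_derive x (delta_mx 0 k) (potential D be) (dpotential D be x k).
    apply: is_derive_potential => j; apply: (xP be) => l; apply: contra.
    by rewrite paddr_eq0 // => /andP[].
  have := @minimal_surface_extremal_radius R f _ S p (x - p) sg _ weight_gt0 Smin sgE v0.
  rewrite subrKC => /(_ _ Sx ext (fun k => is_derive_mulr (dal k) (dbe k))).
  (* The logarithmic derivative of the product splits into one term for each potential; adding and
     subtracting the near fields isolates the errors. *)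
  congr (sg * (1 + _) <= 0); rewrite -!potential_background.
  have p1 : potential D al x != 0 by rewrite gt_eqF // potential_gt0.
  have p2 : potential D be x != 0 by rewrite gt_eqF // potential_gt0.
  rewrite (eq_bigr (fun k => dpotential D al x k * (x - p) 0 k * potential D be x
     + dpotential D be x k * (x - p) 0 k * potential D al x)); last by move=> k _; ring.
  rewrite big_split /= -!mulr_suml ![- _ + (_ + _)]addrC !addrK /f.
  by field; rewrite p1 p2.
have [xM /set_mem SxM maxM] := compact_EVT_max Sne Sc cdist.
have [xm /set_mem Sxm minm] := compact_EVT_min Sne Sc cdist.
have le_max y : S y -> enorm (y - p) <= enorm (xM - p).
  by move=> Sy; apply: maxM; exact: mem_set.
have ge_min y : S y -> enorm (xm - p) <= enorm (y - p).
  by move=> Sy; apply: minm; exact: mem_set.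
have ex_max y : S y -> 1 * (enorm (y - p) - enorm (xM - p)) <= 0.
  by move=> Sy; rewrite mul1r subr_le0 le_max.
have ex_min y : S y -> -1 * (enorm (y - p) - enorm (xm - p)) <= 0.
  by move=> Sy; rewrite mulN1r oppr_le0 subr_ge0 ge_min.
have rM : enorm (xM - p) ^+ 2 <= 2 * (al i * be i).
  have [r0 rD] := key xM 1 SxM (or_introl erefl) ex_max.
  have v0 : xM - p != 0 by rewrite -enorm_gt0.
  rewrite mul1r; have H1 : 1 <= background al i xM by exact: background_ge1.
  have K1 : 1 <= background be i xM by exact: background_ge1.
  have a0 : 0 <= al i / enorm (xM - p) by rewrite divr_ge0 ?enorm_ge0.
  have b0 : 0 <= be i / enorm (xM - p) by rewrite divr_ge0 ?enorm_ge0.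
  move/(neck_arithmetic_max H1 K1 a0 b0 (radial_error_small al_ge0 al_le v0 rD)
    (radial_error_small be_ge0 be_le v0 rD)
    (radial_error_other al_ge0 be_ge0 al_le be_le v0 rD)
    (radial_error_other be_ge0 al_ge0 be_le al_le v0 rD)).
  rewrite (_ : 2 * _ = 2 * (al i * be i) / enorm (xM - p) ^+ 2); last first.
    by field; rewrite gt_eqF.
  by rewrite ler_pdivlMr ?exprn_gt0 // mul1r.
have rm : al i * be i / (2 * (1 + 104 * s) ^+ 2) <= enorm (xm - p) ^+ 2.
  have [r0 rD] := key xm (-1) Sxm (or_intror erefl) ex_min.
  have v0 : xm - p != 0 by rewrite -enorm_gt0.
  rewrite mulN1r oppr_le0; have H1 : 1 <= background al i xm by exact: background_ge1.
  have K1 : 1 <= background be i xm by exact: background_ge1.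
  have a0 : 0 <= al i / enorm (xm - p) by rewrite divr_ge0 ?enorm_ge0.
  have b0 : 0 <= be i / enorm (xm - p) by rewrite divr_ge0 ?enorm_ge0.
  move/(neck_arithmetic_min H1 K1 a0 b0 (radial_error_small al_ge0 al_le v0 rD)
    (radial_error_small be_ge0 be_le v0 rD)
    (radial_error_other al_ge0 be_ge0 al_le be_le v0 rD)
    (radial_error_other be_ge0 al_ge0 be_le al_le v0 rD)).
  set H := background _ _ _ in H1 *; set K := background _ _ _ in K1 * => abHK.
  have HM : H <= 1 + 104 * s by exact: background_le.
  have KM : K <= 1 + 104 * s by exact: background_le.
  have M1 : 1 <= 1 + 104 * s by exact: le_trans H1 HM.
  have HK : H * K <= (1 + 104 * s) ^+ 2.
    by rewrite expr2 ler_pM // (le_trans ler01).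
  rewrite ler_pdivrMr; last by rewrite mulr_gt0 ?exprn_gt0 // (lt_le_trans ltr01).
  rewrite [leRHS]mulrC -ler_pdivrMr ?exprn_gt0 //.
  apply: (@le_trans _ _ (2 * (H * K))); last by rewrite ler_wpM2l.
  rewrite (_ : _ / _ = al i / enorm (xm - p) * (be i / enorm (xm - p))) //.
  by field; rewrite gt_eqF.
move=> y Sy; apply/andP; split.
  apply: le_trans rm _; rewrite ler_pXn2r ?nnegrE ?enorm_ge0 //.
  exact: ge_min.
apply: le_trans rM; rewrite ler_pXn2r ?nnegrE ?enorm_ge0 //.
exact: le_max.
Qed.

End NeckRadius.

(** * Components cut out by a star-shaped surface *)

Section StarSurface.
Context {R : realType}.
Local Notation E := 'rV[R]_3.

Definition basis_vector (k : 'I_3) : E := delta_mx 0 k.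

Lemma enorm_basis_vector k : enorm (basis_vector k) = 1.
Proof.
rewrite /enorm (bigD1 k) //= mxE !eqxx /= expr1n big1 ?addr0 ?sqrtr1 // => j jk.
by rewrite mxE (negbTE jk) andbF expr0n.
Qed.

Lemma eball_segment (rad : R) (x y : E) (t : R) : 0 <= t <= 1 ->
  eball 0 rad x -> eball 0 rad y -> eball 0 rad (x + t *: (y - x)).
Proof.
rewrite /eball /= !subr0 => /andP[t0 t1] hx hy.
have -> : x + t *: (y - x) = (1 - t) *: x + t *: y.
  by apply/rowP => k; rewrite !mxE; ring.
apply: le_lt_trans (ler_enormD _ _) _; rewrite !enormZ !ger0_norm ?subr_ge0 //.
have [->|t0'] := eqVneq t 0; first by rewrite subr0 mul1r mul0r addr0.
have tp : 0 < t by rewrite lt_def t0'.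
have h1 : (1 - t) * enorm x <= (1 - t) * rad by rewrite ler_wpM2l ?subr_ge0 // ltW.
have h2 : t * enorm y < t * rad by rewrite ltr_pM2l.
by move: h1 h2; rewrite !mulrBl; lra.
Qed.

Lemma polar_unique (p w w' : E) (c c' : R) : 0 <= c -> 0 <= c' ->
  enorm w = 1 -> enorm w' = 1 -> p + c *: w = p + c' *: w' ->
  c = c' /\ (c != 0 -> w = w').
Proof.
move=> c0 c0' w1 w1' /addrI h.
have cc : c = c'.
  have := congr1 (@enorm R) h.
  by rewrite !enormZ w1 w1' !mulr1 !ger0_norm.
by split => // cne; move: h; rewrite -cc => /(scalerI cne).
Qed.

Lemma polar_form (p x : E) : x != p ->
  exists w, [/\ enorm w = 1, 0 < enorm (x - p) & x = p + enorm (x - p) *: w].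
Proof.
rewrite -subr_eq0 => xp; have e0 : 0 < enorm (x - p) by rewrite enorm_gt0.
exists ((enorm (x - p))^-1 *: (x - p)); split => //.
  by rewrite enormZ gtr0_norm ?invr_gt0 // mulVf // gt_eqF.
by rewrite scalerA mulfV ?gt_eqF // scale1r addrC subrK.
Qed.

Variables (rad : R) (p : E) (S : set E) (r : E -> R).
Hypotheses (Sc : compact S) (r_gt0 : forall w, enorm w = 1 -> 0 < r w).
Hypothesis SE : S = [set p + r w *: w | w in [set w | enorm w = 1]].
Hypothesis p_ball : eball 0 rad p.

Lemma star_surface_center : ~ S p.
Proof.
rewrite SE => -[w /= w1 pw]; have := r_gt0 w1.
have [] := @polar_unique p w w (r w) 0 (ltW (r_gt0 w1)) (lexx 0) w1 w1.
  by rewrite pw scale0r addr0.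
by move=> ->; rewrite ltxx.
Qed.

Lemma star_surface_polar w c : enorm w = 1 -> 0 <= c -> S (p + c *: w) -> c = r w.
Proof.
move=> w1 c0; rewrite SE => -[w' /= w1' h].
have [e1 e2] := polar_unique (ltW (r_gt0 w1')) c0 w1' w1 h.
by rewrite -e1 -e2 // gt_eqF // r_gt0.
Qed.

(** A point strictly inside the surface is joined to [p] by a radial segment, which avoids [S]
    because a ray meets [S] only once. *)
Lemma Out_polar x : Out rad p S x ->
  exists w c, [/\ enorm w = 1, r w < c & x = p + c *: w].
Proof.
move=> [[xb xS] ncc].
have [xp|xp] := eqVneq x p.
  exfalso; apply: ncc; rewrite xp; apply: connected_component_refl.
  by split => //; exact: star_surface_center.
have [w [w1 c0 xE]] := polar_form xp; exists w, (enorm (x - p)); split => //.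
set c := enorm _ in c0 xE *.
have [//|cr|cr] := ltgtP (r w) c; last first.
  by exfalso; apply: xS; rewrite SE; exists w => //; rewrite cr.
exfalso; apply: ncc.
pose seg (t : R) : E := p + t *: (x - p).
exists (seg @` `[0, 1]); last first.
  by exists 0 => /=; rewrite ?in_itv /= ?lexx ?ler01 // /seg scale0r addr0.
split.
- by exists 1 => /=; rewrite ?in_itv /= ?lexx ?ler01 // /seg scale1r addrC subrK.
- move=> y /= [t]; rewrite in_itv /= => t01 <-; split; first exact: eball_segment.
  have segE : seg t = p + (t * c) *: w.
    have xmp : x - p = c *: w by rewrite {1}xE addrC addKr.
    by rewrite /seg xmp scalerA.
  have /andP[t0 t1] := t01.
  rewrite segE => /star_surface_polar => /(_ w1 (mulr_ge0 t0 (ltW c0))) tc.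
  by move: cr; rewrite -tc ltNge ler_piMl // ltW.
- apply: connected_continuous_connected; first exact: segment_connected.
  apply: continuous_subspaceT => t; apply: cvgD; first exact: cvg_cst.
  by apply: cvgZr_tmp; exact: cvg_id.
Qed.

(** Dilates of the compact [S] describe its inside and its outside as closed sets, with compactness
    in the role that continuity of [r] would play. *)
Lemma compact_rescaling (a b : R) :
  compact [set p + z.1 *: (z.2 - p) | z in `[a, b]%classic `*` S].
Proof.
apply: (@continuous_compact _ _ (fun z : R * E => p + z.1 *: (z.2 - p))).
  apply: continuous_subspaceT => z; apply: cvgD; first exact: cvg_cst.
  apply: cvgZ; first exact: cvg_fst.
  by apply: cvgB; [exact: cvg_snd | exact: cvg_cst].
by apply: compact_setX => //; exact: segment_compact.
Qed.

Lemma closed_rescaling (a b : R) :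
  closed [set p + z.1 *: (z.2 - p) | z in `[a, b]%classic `*` S].
Proof. by apply: compact_closed; [exact: norm_hausdorff | exact: compact_rescaling]. Qed.

(* A connected set through [p] avoiding [S] meets the compact set
   [K1 = {p + t (y - p) | t <= 1, y in S}] in a relatively clopen set, its
   complement being cut out by [K2 = {p + t (y - p) | t >= 1, y in S}]. *)
Lemma polar_Out w c : eball 0 rad (p + c *: w) -> enorm w = 1 -> r w < c ->
  Out rad p S (p + c *: w).
Proof.
move=> xb w1 rc; have c0 : 0 <= c by rewrite ltW // (lt_trans _ rc) // r_gt0.
split.
  split => // /(star_surface_polar w1 c0) cr; by move: rc; rewrite cr ltxx.
move=> [T [Tx TA Tc] Tp].
have pu (u : E) : p + u - p = u by rewrite addrC addKr.
have Sw u : enorm u = 1 -> S (p + r u *: u) by move=> u1; rewrite SE; exists u.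
have Sne : S !=set0 by exists (p + r w *: w); exact: Sw.
have [m /set_mem Sm mmin] := compact_EVT_min Sne Sc
  (continuous_subspaceT (@continuous_enormB R p)).
have m0 : 0 < enorm (m - p).
  by rewrite enorm_gt0 subr_eq0; apply/eqP => mp; apply: star_surface_center; rewrite -mp.
have rm u : enorm u = 1 -> enorm (m - p) <= r u.
  move=> u1; have := mmin _ (mem_set (Sw u u1)).
  by rewrite pu enormZ u1 mulr1 gtr0_norm // r_gt0.
(* Points of the ball are within [2 rad] of [p] and [S] is at least [|m - p|] away, so dilations up
   to [L] reach every point of the ball beyond [S]. *)
pose L := 2 * rad / enorm (m - p).
pose K (a b : R) := [set p + z.1 *: (z.2 - p) | z in `[a, b]%classic `*` S].
have K01 u d : enorm u = 1 -> 0 < d -> K 0 1 (p + d *: u) <-> d <= r u.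
  move=> u1 d0; have ru := r_gt0 u1; split.
    move=> [[t y] /= [+ Sy] h]; rewrite in_itv /= => /andP[t0 t1].
    move: Sy h; rewrite SE => -[u' /= u1' <-].
    rewrite pu scalerA => /esym h.
    have [dE uE] := polar_unique (ltW d0) (mulr_ge0 t0 (ltW (r_gt0 u1'))) u1 u1' h.
    by rewrite dE uE ?gt_eqF // ler_piMl // ltW // r_gt0.
  move=> dr; exists (d / r u, p + r u *: u) => /=.
    split; last exact: Sw.
    by rewrite in_itv /= divr_ge0 ?(ltW d0) ?(ltW ru) //= ler_pdivrMr // mul1r.
  by rewrite pu scalerA divfK ?gt_eqF.
have K1L u d : enorm u = 1 -> 0 < d -> d <= 2 * rad ->
    K 1 L (p + d *: u) <-> r u <= d.
  move=> u1 d0 dR; have ru := r_gt0 u1; split.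
    move=> [[t y] /= [+ Sy] h]; rewrite in_itv /= => /andP[t1 tL].
    move: Sy h; rewrite SE => -[u' /= u1' <-].
    rewrite pu scalerA => /esym h.
    have t0 : 0 <= t by rewrite (le_trans _ t1).
    have [dE uE] := polar_unique (ltW d0) (mulr_ge0 t0 (ltW (r_gt0 u1'))) u1 u1' h.
    by rewrite dE uE ?gt_eqF // ler_peMl // ltW // r_gt0.
  move=> dr; exists (d / r u, p + r u *: u) => /=.
    split; last exact: Sw.
    rewrite in_itv /= ler_pdivlMr // mul1r dr /= /L.
    by rewrite ler_pM ?invr_ge0 ?(ltW d0) ?(ltW ru) // lef_pV2 ?posrE // rm.
  by rewrite pu scalerA divfK ?gt_eqF.
have Kp01 : K 0 1 p.
  exists (0, p + r w *: w) => /=; last by rewrite scale0r addr0.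
  by split; [rewrite in_itv /= lexx ler01 | exact: Sw].
have Kp1L : ~ K 1 L p.
  move=> [[t y] /= [+ Sy] h]; rewrite in_itv /= => /andP[t1 tL].
  have t0 : t != 0 by rewrite gt_eqF // (lt_le_trans _ t1).
  apply: star_surface_center; suff <- : y = p by [].
  move: h => /eqP; rewrite -subr_eq0 pu scaler_eq0 (negbTE t0) /=.
  by rewrite subr_eq0 => /eqP.
have dist y : T y -> enorm (y - p) <= 2 * rad.
  move=> /TA[yb _]; apply: le_trans (ler_enormD _ _) _; rewrite enormN.
  by move: yb p_ball; rewrite /eball /= !subr0; lra.
have B1 : T `&` K 0 1 = T `&` ~` K 1 L.
  apply/seteqP; split => y [Ty]; have [->|yp] := eqVneq y p => //=.
    have [u [u1 d0 yE]] := polar_form yp.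
    move=> Ky; split => //.
    have h1 : enorm (y - p) <= r u by apply/(K01 _ _ u1 d0); rewrite -yE.
    rewrite yE => /(K1L _ _ u1 d0 (dist _ Ty)) h2.
    have [_] := TA _ Ty; apply; rewrite yE.
    have -> : enorm (y - p) = r u by apply/eqP; rewrite eq_le h1 h2.
    exact: Sw.
  have [u [u1 d0 yE]] := polar_form yp.
  move=> Ky; split => //; rewrite yE; apply/(K01 _ _ u1 d0).
  rewrite leNgt; apply/negP => h1; apply: Ky; rewrite yE.
  by apply/(K1L _ _ u1 d0 (dist _ Ty)); exact: ltW.
have : T `&` K 0 1 = T.
  apply: Tc.
  - by exists p.
  - exists (~` K 1 L) => //; exact/closed_openC/closed_rescaling.
  - by exists (K 0 1) => //; exact: closed_rescaling.
move=> TE; have [_] : (T `&` K 0 1) (p + c *: w) by rewrite TE.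
have cp : 0 < c by apply: lt_trans rc; exact: r_gt0.
by move=> /(K01 _ _ w1 cp); rewrite leNgt rc.
Qed.

End StarSurface.

(** * Lengths and distances *)

Section ArcLength.
Context {R : realType}.
Local Notation E := 'rV[R]_3.
Local Notation mu := (@lebesgue_measure R).

Lemma unit_interval_integrable (h : R -> R) :
  (forall t, 0 <= t <= 1 -> {for t, continuous h}) ->
  mu.-integrable `[0, 1] (EFin \o h).
Proof.
move=> ch; apply: continuous_compact_integrable; first exact: segment_compact.
apply: continuous_in_subspaceT => t /set_mem /=.
by rewrite in_itv /=; exact: ch.
Qed.

Lemma Rintegral_derivative (G dG : R -> R) :
  (forall t : R, 0 <= t <= 1 -> is_derive t 1 G (dG t)) ->
  (forall t, 0 <= t <= 1 -> {for t, continuous dG}) ->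
  \int[mu]_(t in `[0, 1]) dG t = G 1 - G 0.
Proof.
move=> dGt cdG.
have cG (t : R) : 0 <= t <= 1 -> G x @[x --> t] --> G t.
  move=> t01; apply: differentiable_continuous; apply/derivable1_diffP.
  by case: (dGt _ t01).
rewrite /Rintegral (@continuous_FTC2 _ dG G 0 1) //.
- apply: continuous_in_subspaceT => t /set_mem /=.
  by rewrite in_itv /=; exact: cdG.
- split.
  + by move=> t; rewrite in_itv /= => /andP[t0 t1]; case: (dGt t) => //; rewrite !ltW.
  + by apply: cvg_at_right_filter; apply: cG; rewrite lexx ler01.
  + by apply: cvg_at_left_filter; apply: cG; rewrite lexx ler01.
- move=> t; rewrite in_itv /= => /andP[t0 t1]; rewrite derive1E.
  by case: (dGt t) => //; rewrite !ltW.
Qed.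

Variable (f : E -> R).
Hypothesis f_gt0 : forall x, 0 < f x.
Local Notation g := (fun x => (f x ^+ 2)%:M : 'M[R]_3).

Lemma arc_lengthE c : arc_length g c =
  \int[mu]_(t in `[0, 1]) (f (c t) * enorm (derive1 c t)).
Proof.
rewrite /arc_length; apply: eq_Rintegral => t _.
exact: gnorm_conformal.
Qed.

Lemma speed_continuous (c : R -> E) (t : R) : C1_arc c ->
  {for c t, continuous f} ->
  {for t, continuous (fun t => f (c t) * enorm (derive1 c t))}.
Proof.
move=> [dc cdc] cf.
have cc : {for t, continuous c}.
  by apply: differentiable_continuous; apply/derivable1_diffP.
apply: cvgM.
  exact: (@continuous_comp _ _ _ c f).
apply: (@continuous_comp _ _ _ (derive1 c) (@enorm R)); first exact: cdc.
exact: enorm_continuous.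
Qed.

Section Comparison.
Variables (c : R -> E) (G dG : R -> R).
Hypothesis Cc : C1_arc c.
Hypothesis cf : forall t, 0 <= t <= 1 -> {for c t, continuous f}.
Hypothesis dGt : forall t : R, 0 <= t <= 1 -> is_derive t 1 G (dG t).
Hypothesis cdG : forall t, 0 <= t <= 1 -> {for t, continuous dG}.

(** [G] acts as a calibration: lengths are bounded by comparing speeds with [dG], without evaluating
    a length integral. *)
Lemma arc_length_ge :
  (forall t, 0 <= t <= 1 -> dG t <= f (c t) * enorm (derive1 c t)) ->
  G 1 - G 0 <= arc_length g c.
Proof.
move=> h; rewrite arc_lengthE -(Rintegral_derivative dGt cdG).
apply: le_Rintegral => //.
- exact: unit_interval_integrable.
- by apply: unit_interval_integrable => t t01; exact: speed_continuous Cc (cf t01).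
Qed.

Lemma arc_length_le :
  (forall t, 0 <= t <= 1 -> f (c t) * enorm (derive1 c t) <= dG t) ->
  arc_length g c <= G 1 - G 0.
Proof.
move=> h; rewrite arc_lengthE -(Rintegral_derivative dGt cdG).
apply: le_Rintegral => //.
- by apply: unit_interval_integrable => t t01; exact: speed_continuous Cc (cf t01).
- exact: unit_interval_integrable.
Qed.

End Comparison.

Definition segment (x y : E) (t : R) : E := x + t *: (y - x).

Lemma segment0 x y : segment x y 0 = x.
Proof. by rewrite /segment scale0r addr0. Qed.

Lemma segment1 x y : segment x y 1 = y.
Proof. by rewrite /segment scale1r addrC subrK. Qed.

Lemma is_derive_segment (x y : E) (t : R) : is_derive t 1 (segment x y) (y - x).
Proof.
have d i j : is_derive t 1 (fun u => segment x y u i j) ((y - x) i j).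
  have -> : (fun u => segment x y u i j) = (fun u => x i j + (y - x) i j * u).
    by apply/funext => u; rewrite !mxE mulrC.
  by apply: is_derive_eq; rewrite /GRing.scale /=; ring.
have ds : derivable (segment x y) t 1.
  by apply/derivable_mxP => i j; case: (d i j).
apply: DeriveDef => //; rewrite derive_mx //; apply/matrixP => i j.
by rewrite mxE; case: (d i j).
Qed.

Lemma derive1_segment x y t : derive1 (segment x y) t = y - x.
Proof. by rewrite derive1E; case: (is_derive_segment x y t). Qed.

Lemma segment_C1 x y : C1_arc (segment x y).
Proof.
split=> [t|]; first by case: (is_derive_segment x y t).
have -> : derive1 (segment x y) = cst (y - x).
  by apply/funext => t; rewrite derive1_segment.
by move=> t; exact: cst_continuous.
Qed.

End ArcLength.

(** * Piecewise paths and bounds for the distance *)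

Section Paths.
Context {R : realType}.
Local Notation E := 'rV[R]_3.

Section Lengths.
Variables (g : E -> 'M[R]_3) (V : set E).

Lemma is_path_cat x cs y ds z : is_path V x cs y -> is_path V y ds z ->
  is_path V x (cs ++ ds) z.
Proof.
elim: cs x => [|c cs ih] x /=; first by move=> ->.
by move=> [Cc cV c0 h1] h2; split => //; exact: ih.
Qed.

(** Both directions are recorded, so that symmetry is immediate and only segments ever have to be
    reversed. *)
Definition joined (B : R) (x y : E) :=
  (exists2 cs, is_path V x cs y & path_length g cs <= B) /\
  (exists2 cs, is_path V y cs x & path_length g cs <= B).

Lemma joined_trans (B B' : R) x y z :
  joined B x y -> joined B' y z -> joined (B + B') x z.
Proof.
move=> [[c1 p1 l1] [c2 p2 l2]] [[d1 q1 m1] [d2 q2 m2]]; split.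
  exists (c1 ++ d1); first exact: is_path_cat p1 q1.
  by rewrite /path_length big_cat lerD.
exists (d2 ++ c2); first exact: is_path_cat q2 p2.
by rewrite /path_length big_cat addrC lerD.
Qed.

Lemma joined_sym B x y : joined B x y -> joined B y x.
Proof. by case. Qed.

Lemma gdist_joined B x y : joined B x y -> (gdist g V x y <= B%:E)%E.
Proof.
move=> [[cs pcs lcs] _]; apply: ge_ereal_inf; exists (path_length g cs)%:E => //.
by exists cs.
Qed.

Lemma gdist_ge (Phi : E -> R) x y :
  (forall c, C1_arc c -> (forall t, 0 <= t <= 1 -> V (c t)) ->
     Phi (c 1) - Phi (c 0) <= arc_length g c) ->
  ((Phi y - Phi x)%:E <= gdist g V x y)%E.
Proof.
move=> h; apply: le_ereal_inf_tmp => _ [cs /= pcs <-]; rewrite lee_fin.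
elim: cs x pcs => [x /= ->|c cs ih x /= [Cc cV c0 pcs]].
  by rewrite /path_length big_nil subrr.
rewrite /path_length big_cons -(subrKA (Phi (c 1))) addrC.
by apply: lerD; [rewrite -c0; exact: h | exact: ih].
Qed.

End Lengths.

Section ConformalSegments.
Variables (f : E -> R) (V : set E).
Hypothesis f_gt0 : forall x, 0 < f x.
Hypothesis f_continuous : forall x, V x -> {for x, continuous f}.
Local Notation g := (fun x => (f x ^+ 2)%:M : 'M[R]_3).

Lemma segmentC (x y : E) t : segment y x t = segment x y (1 - t).
Proof. by apply/rowP => k; rewrite !mxE; ring. Qed.

Lemma joined_segment (x y : E) (G dG : R -> R) :
  (forall t, 0 <= t <= 1 -> V (segment x y t)) ->
  (forall t : R, 0 <= t <= 1 -> is_derive t 1 G (dG t)) ->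
  (forall t, 0 <= t <= 1 -> {for t, continuous dG}) ->
  (forall t, 0 <= t <= 1 -> f (segment x y t) * enorm (y - x) <= dG t) ->
  joined g V (G 1 - G 0) x y.
Proof.
move=> sV dGt cdG fG.
have sub01 (t : R) : 0 <= t <= 1 -> 0 <= 1 - t <= 1.
  by move=> /andP[? ?]; apply/andP; split; lra.
split.
  exists [:: segment x y].
    by split => //=; [exact: segment_C1 | exact: segment0 | exact: segment1].
  rewrite /path_length big_seq1; apply: (@arc_length_le _ _ f_gt0 _ G dG) => //.
  - exact: segment_C1.
  - by move=> t t01; exact/f_continuous/sV.
  - by move=> t t01; rewrite derive1_segment fG.
exists [:: segment y x].
  split => //=; [exact: segment_C1 | | exact: segment0 | exact: segment1].
  by move=> t t01; rewrite segmentC; exact/sV/sub01.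
(* The reversed segment has the primitive [- G (1 - t)], with the same total increment. *)
have -> : G 1 - G 0 = (fun t : R => - G (1 - t)) 1 - (fun t : R => - G (1 - t)) 0.
  by rewrite subrr subr0 opprK addrC.
rewrite /path_length big_seq1.
apply: (@arc_length_le _ _ f_gt0 (segment y x) (fun t => - G (1 - t))
  (fun t => dG (1 - t))) => //.
- exact: segment_C1.
- by move=> t t01; rewrite segmentC; exact/f_continuous/sV/sub01.
- move=> t t01.
  have d1 : is_derive t 1 (fun u : R => 1 - u) (-1).
    by apply: is_derive_eq; rewrite add0r mul1r.
  have := @is_derive_compr R R G (fun u => 1 - u) t 1 _ _ (dGt _ (sub01 _ t01)) d1.
  rewrite mulrN1 => d2.
  by have := @is_deriveN _ _ _ _ _ _ _ d2; rewrite opprK.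
- move=> t t01; apply: (@continuous_comp _ _ _ (fun t : R => 1 - t) dG).
    by apply: cvgB; [exact: cvg_cst | exact: cvg_id].
  exact/cdG/sub01.
- by move=> t t01; rewrite derive1_segment segmentC enormBC fG // sub01.
Qed.

Lemma joined_segment_bounded (x y : E) (M : R) :
  (forall t, 0 <= t <= 1 -> V (segment x y t)) ->
  (forall t, 0 <= t <= 1 -> f (segment x y t) <= M) ->
  joined g V (M * enorm (y - x)) x y.
Proof.
move=> sV fM; pose G (t : R) := (M * enorm (y - x)) * t.
have -> : M * enorm (y - x) = G 1 - G 0 by rewrite /G mulr1 mulr0 subr0.
apply: (@joined_segment _ _ G (cst (M * enorm (y - x)))) => //.
- by move=> t _; apply: is_derive_eq; rewrite /GRing.scale /=; ring.
- by move=> t _; exact: cst_continuous.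
- by move=> t t01; rewrite ler_wpM2r ?enorm_ge0 ?fM.
Qed.

Lemma derivable_coordinates (c : R -> E) (t : R) k : derivable c t 1 ->
  is_derive t 1 (fun u => c u 0 k) (derive1 c t 0 k).
Proof.
move=> dc; apply: DeriveDef; first by move/derivable_mxP: dc; exact.
by rewrite derive1E derive_mx // mxE.
Qed.

(** [kappa * ln |z - p|] is 1-Lipschitz for the metric, since its Euclidean gradient has norm
    [kappa / |z - p| <= f]. *)
Lemma gdist_ge_log (p : E) (kappa : R) (x y : E) : 0 <= kappa -> ~ V p ->
  (forall z, V z -> kappa / enorm (z - p) <= f z) ->
  ((kappa * ln (enorm (y - p)) - kappa * ln (enorm (x - p)))%:E
     <= gdist g V x y)%E.
Proof.
move=> k0 Vp fk; apply: (gdist_ge (Phi := fun x => kappa * ln (enorm (x - p)))).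
move=> c Cc cV; have [dc cdc] := Cc.
have cp t : 0 <= t <= 1 -> c t - p != 0.
  by move=> /cV ct; rewrite subr_eq0; apply/eqP => cp; apply: Vp; rewrite -cp.
have ep t : 0 <= t <= 1 -> 0 < enorm (c t - p) by move=> /cp; rewrite enorm_gt0.
pose N t := \sum_k (c t - p) 0 k * derive1 c t 0 k.
have cc t : {for t, continuous c}.
  by apply: differentiable_continuous; apply/derivable1_diffP.
have cep t : {for t, continuous (fun t => enorm (c t - p))}.
  apply: (@continuous_comp _ _ _ c (fun y => enorm (y - p))); first exact: cc.
  exact: continuous_enormB.
apply: (@arc_length_ge _ _ f_gt0 c (fun t => kappa * ln (enorm (c t - p)))
   (fun t => kappa * (N t / enorm (c t - p) ^+ 2))) => //.
- by move=> t t01; exact/f_continuous/cV.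
- move=> t t01.
  have dk k : is_derive t 1 (fun u => (c u - p) 0 k) (derive1 c t 0 k).
    have -> : (fun u => (c u - p) 0 k) = (fun u => c u 0 k + - p 0 k).
      by apply/funext => u; rewrite !mxE.
    rewrite -[derive1 c t 0 k]addr0.
    apply: (is_derive_addr _ (is_derive_cst (- p 0 k) t _)).
    exact: derivable_coordinates.
  have de := is_derive_enorm_curve dk (cp _ t01).
  have dl := @is_derive_compr R R (@ln R) (fun u => enorm (c u - p)) t 1 _ _
    (is_derive1_ln (ep _ t01)) de.
  apply: (is_derive_eq (is_derive_mulr (is_derive_cst kappa t 1) dl)).
  rewrite mul0r add0r /N; congr (kappa * _); field.
  by rewrite gt_eqF // ep.
- move=> t t01; apply: cvgMl_tmp; apply: cvgM.
    apply: (@cvg_sumr R R (nbhs t) _) => k _; apply: cvgM.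
      have -> : (fun u => (c u - p) 0 k) = (fun u => c u 0 k - p 0 k).
        by apply/funext => u; rewrite !mxE.
      rewrite [(c t - p) 0 k](_ : _ = c t 0 k - p 0 k); last by rewrite !mxE.
      apply: cvgB; last exact: cvg_cst.
      apply: (@continuous_comp _ _ _ c (fun y : E => y 0 k)); first exact: cc.
      exact: coord_continuous.
    apply: (@continuous_comp _ _ _ (derive1 c) (fun y : E => y 0 k)).
      exact: cdc.
    exact: coord_continuous.
  apply: cvgV; first by rewrite expf_neq0 // gt_eqF // ep.
  apply: (@continuous_comp _ _ _ (fun t => enorm (c t - p)) (fun u => u ^+ 2)).
    exact: cep.
  exact: exprn_continuous.
- move=> t t01; have e0 := ep _ t01.
  apply: le_trans (ler_wpM2r (enorm_ge0 _) (fk _ (cV _ t01))).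
  rewrite -!mulrA ler_wpM2l // ler_pdivrMr ?exprn_gt0 //.
  rewrite [leRHS](_ : _ = enorm (c t - p) * enorm (derive1 c t)).
    exact: cauchy_schwarz.
  by field; rewrite gt_eqF.
Qed.

Lemma gdist_ge_coord (k : 'I_3) (x y : E) :
  (forall z, V z -> 1 <= f z) ->
  ((y 0 k - x 0 k)%:E <= gdist g V x y)%E.
Proof.
move=> f1; apply: (gdist_ge (Phi := fun x : E => x 0 k)) => c Cc cV.
have [dc cdc] := Cc.
apply: (@arc_length_ge _ _ f_gt0 c (fun t => c t 0 k) (fun t => derive1 c t 0 k)) => //.
- by move=> t t01; exact/f_continuous/cV.
- by move=> t _; exact: derivable_coordinates.
- move=> t _; apply: (@continuous_comp _ _ _ (derive1 c) (fun y : E => y 0 k)).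
    exact: cdc.
  exact: coord_continuous.
- move=> t t01; apply: le_trans (ler_norm _) _.
  apply: le_trans (coord_le_enorm _ _) _.
  by rewrite -[leLHS]mul1r ler_wpM2r ?enorm_ge0 //; exact/f1/cV.
Qed.

End ConformalSegments.
End Paths.

(** * The outer region *)

Lemma coordB {R : realType} (x y : 'rV[R]_3) k : (x - y) 0 k = x 0 k - y 0 k.
Proof. by rewrite !mxE. Qed.

Section OuterRegion.
Context {R : realType}.
Local Notation E := 'rV[R]_3.
Variables (D s rad : R) (n : nat) (al be : box n -> R) (Sigma : box n -> set E).
Hypotheses (D_gt0 : 0 < D) (n_gt0 : (0 < n)%N) (s_ge0 : 0 <= s).
Hypotheses (al_ge0 : forall i, 0 <= al i) (be_ge0 : forall i, 0 <= be i).
Hypothesis al_le : forall i, al i <= s * D / n%:R ^+ 3.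
Hypothesis be_le : forall i, be i <= s * D / n%:R ^+ 3.
Hypothesis n_large : 1000 * (1 + s) <= n%:R.
Hypothesis al_be : forall i, al i + be i != 0 -> al i * be i != 0.
Hypothesis rad_gt : Num.sqrt 3 * D < rad.
Hypothesis Sigma_neck :
  forall i, al i * be i != 0 -> neck_surface D al be i (Sigma i).

Local Notation p := (@Defs.center R D n).
Local Notation M := (1 + 104 * s).
Local Notation h := (D / (2 * n%:R)).
Local Notation V := (outer_region D al be rad Sigma).
Let f (x : E) := potential D al x * potential D be x.

Let nR_gt0 : 0 < n%:R :> R. Proof. by rewrite ltr0n. Qed.
Let h_gt0 : 0 < h. Proof. by rewrite divr_gt0 ?mulr_gt0. Qed.

Lemma D_lt_rad : D < rad.
Proof.
apply: le_lt_trans rad_gt; rewrite -[leLHS]mul1r ler_wpM2r ?(ltW D_gt0) //.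
by rewrite -[leLHS]sqrtr1 ler_wsqrtr // ler1n.
Qed.

(** The half-diagonal of the cube is [sqrt 3 * D]. *)
Lemma cube_sub_ball (x : E) : (forall k, `|x 0 k| <= D) -> eball 0 rad x.
Proof.
move=> xD; rewrite /eball /= subr0; apply: le_lt_trans rad_gt.
rewrite -(@ler_pXn2r _ 2) ?nnegrE ?mulr_ge0 ?enorm_ge0 ?sqrtr_ge0 ?(ltW D_gt0) //.
rewrite sqr_enorm exprMn sqr_sqrtr ?ler0n //.
apply: (@le_trans _ _ (\sum_(k < 3) D ^+ 2)).
  apply: ler_sum => k _; rewrite -(@real_normK _ (x 0 k)) ?num_real //.
  by rewrite ler_pXn2r ?nnegrE ?(ltW D_gt0).
by rewrite sumr_const card_ord mulr_natl.
Qed.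

Lemma center_coord_le (i : box n) k : `|p i 0 k| <= D - h.
Proof.
rewrite !mxE ler_norml.
have i1 : (i k)%:R + 1 <= 2 * n%:R :> R.
  by rewrite natr1 -natrM ler_nat.
have i0 : 0 <= (i k)%:R :> R by rewrite ler0n.
have hn : D / n%:R = 2 * h by field; rewrite gt_eqF.
have Dh : D = 2 * n%:R * h by field; rewrite gt_eqF.
rewrite hn; move: Dh h_gt0 i1 i0; move: (h) ((i k)%:R) => hh m Dh h0 i1 i0.
have e1 : 0 <= hh * m by rewrite mulr_ge0 // ltW.
have e2 : 0 <= hh * (2 * n%:R - 1 - m) by rewrite mulr_ge0 ?(ltW h0) //; lra.
by apply/andP; split; lra.
Qed.

Lemma center_in_ball i : eball 0 rad (p i).
Proof.
apply: cube_sub_ball => k; apply: le_trans (center_coord_le i k) _.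
by rewrite gerBl ltW.
Qed.

(** The constant comes from the lower bound at a neck, where the fourth power of [h / r] with
    [r = 2 sqrt (al i * be i)] produces [256 n ^ 4]. *)
Lemma product_small i : 256 * n%:R ^+ 4 * (al i * be i) <= D ^+ 2.
Proof.
have n0 : n%:R != 0 :> R by rewrite gt_eqF.
apply: (@le_trans _ _ (256 * n%:R ^+ 4 * ((s * D / n%:R ^+ 3) * (s * D / n%:R ^+ 3)))).
  by rewrite ler_wpM2l ?mulr_ge0 ?exprn_ge0 ?ler0n // ler_pM.
rewrite (_ : _ * _ = (16 * s / n%:R) ^+ 2 * D ^+ 2); last by field.
rewrite -[leRHS]mul1r ler_wpM2r ?sqr_ge0 // expr_le1 //.
  by rewrite ler_pdivrMr // mul1r; move: n_large s_ge0; lra.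
by rewrite divr_ge0 ?mulr_ge0 ?ler0n.
Qed.

Lemma neck_radius_lt i y : al i * be i != 0 -> Sigma i y -> enorm (y - p i) < h.
Proof.
move=> ab Sy; have /andP[_ le2] :=
  neck_radius D_gt0 n_gt0 al_ge0 be_ge0 s_ge0 al_le be_le n_large ab
    (Sigma_neck ab) Sy.
have n1 : 1 <= n%:R ^+ 2 :> R by rewrite exprn_ege1 // ler1n.
rewrite -(@ltr_pXn2r _ 2) ?nnegrE ?enorm_ge0 ?(ltW h_gt0) //.
apply: le_lt_trans le2 _.
have ab0 : 0 < al i * be i by rewrite lt_def ab mulr_ge0.
rewrite expr_div_n ltr_pdivlMr ?exprn_gt0 ?mulr_gt0 //.
apply: lt_le_trans (product_small i).
rewrite [ltLHS](_ : _ = 8 * n%:R ^+ 2 * (al i * be i)); last by ring.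
rewrite ltr_pM2r // (_ : n%:R ^+ 4 = n%:R ^+ 2 * n%:R ^+ 2); last by ring.
have : n%:R ^+ 2 <= n%:R ^+ 2 * n%:R ^+ 2 :> R by rewrite ler_peMr ?sqr_ge0.
lra.
Qed.

Lemma neck_star i : al i * be i != 0 -> exists r : E -> R,
  [/\ compact (Sigma i), forall w, enorm w = 1 -> 0 < r w &
      Sigma i = [set p i + r w *: w | w in [set w | enorm w = 1]]].
Proof.
move=> ab; have [[_ Sc _ _ _] _ [r [r0 SE]]] := Sigma_neck ab.
by exists r.
Qed.

Lemma neck_point_norm i (r : E -> R) w : (forall w, enorm w = 1 -> 0 < r w) ->
  enorm w = 1 -> enorm (p i + r w *: w - p i) = r w.
Proof.
by move=> r0 w1; rewrite addrC addKr enormZ w1 mulr1 gtr0_norm // r0.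
Qed.

Lemma Out_beyond i x : al i * be i != 0 -> eball 0 rad x ->
  (forall y, Sigma i y -> enorm (y - p i) < enorm (x - p i)) ->
  Out rad (p i) (Sigma i) x.
Proof.
move=> ab xb far; have [r [Sc r0 SE]] := neck_star ab.
have Sw w : enorm w = 1 -> r w < enorm (x - p i).
  move=> w1; rewrite -(@neck_point_norm i r w) //; apply: far.
  by rewrite SE; exists w.
have xp : x != p i.
  rewrite -subr_eq0 -enorm_gt0; have e1 := enorm_basis_vector (R := R) ord0.
  exact: lt_trans (r0 _ e1) (Sw _ e1).
have [w [w1 c0 xE]] := polar_form xp.
rewrite xE; apply: (polar_Out Sc r0 SE (center_in_ball i)) => //.
  by rewrite -xE.
exact: Sw.
Qed.

Lemma Out_far i x : al i * be i != 0 -> eball 0 rad x -> h <= enorm (x - p i) ->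
  Out rad (p i) (Sigma i) x.
Proof.
move=> ab xb hx; apply: Out_beyond => // y Sy.
exact: lt_le_trans (neck_radius_lt ab Sy) hx.
Qed.

Lemma Out_outward i x t : al i * be i != 0 -> Out rad (p i) (Sigma i) x -> 1 <= t ->
  eball 0 rad (p i + t *: (x - p i)) ->
  Out rad (p i) (Sigma i) (p i + t *: (x - p i)).
Proof.
move=> ab; have [r [Sc r0 SE]] := neck_star ab.
move=> /(Out_polar r0 SE (center_in_ball i))[w [c [w1 rc ->]]] t1.
rewrite (addrC (p i) (c *: w)) addrK scalerA => tb.
apply: (polar_Out Sc r0 SE (center_in_ball i)) => //.
apply: (lt_le_trans rc); rewrite ler_peMl // ltW // (lt_trans _ rc) //.
exact: r0.
Qed.

Lemma Out_radius i x : al i * be i != 0 -> Out rad (p i) (Sigma i) x ->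
  0 < enorm (x - p i) /\
  al i * be i / (2 * M ^+ 2) <= enorm (x - p i) ^+ 2.
Proof.
move=> ab; have [r [Sc r0 SE]] := neck_star ab.
move=> /(Out_polar r0 SE (center_in_ball i))[w [c [w1 rc ->]]].
have c0 : 0 < c by rewrite (lt_trans _ rc) // r0.
rewrite addrC addKr enormZ w1 mulr1 gtr0_norm //; split => //.
have Sw : Sigma i (p i + r w *: w) by rewrite SE; exists w.
have /andP[+ _] :=
  neck_radius D_gt0 n_gt0 al_ge0 be_ge0 s_ge0 al_le be_le n_large ab
    (Sigma_neck ab) Sw.
rewrite neck_point_norm // => /le_trans; apply.
by rewrite ler_pXn2r ?nnegrE ?ltW // r0.
Qed.

(** A center of [Pstar] carries a neck by [al_be], and points beyond a neck are at positive distance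
    from its center. *)
Lemma outer_regionP x : V x <->
  eball 0 rad x /\ forall i, al i * be i != 0 -> Out rad (p i) (Sigma i) x.
Proof.
split=> [[[xb xO] _]|[xb xO]]; first by split => // i ab; exact: xO.
split; first by split => // i ab; exact: xO.
move=> [i /= abi xE]; have ab := al_be abi.
have [] := Out_radius ab (xO i ab).
by rewrite -xE subrr enorm0 ltxx.
Qed.

Lemma outer_region_off_center x : eball 0 rad x ->
  (forall j : box n, off_center D x j) -> V x.
Proof.
move=> xb off; apply/outer_regionP; split => // i ab; apply: Out_far => //.
exact: off_center_enorm.
Qed.

Lemma outer_region_avoids x : V x -> forall i, al i + be i != 0 -> x != p i.
Proof. by move=> [_ xP] i abi; apply/eqP => xE; apply: xP; exists i. Qed.

Lemma potential_continuous (a : box n -> R) (x : E) :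
  (forall i, a i != 0 -> x != p i) -> {for x, continuous (potential D a)}.
Proof.
move=> xP; apply: (@cvgD _ _ _ (nbhs x)); first exact: cvg_cst.
apply: (@cvg_sumr R E (nbhs x) _) => i _; have [ai0|ai0] := eqVneq (a i) 0.
  by rewrite ai0 mul0r; under eq_fun do rewrite mul0r; exact: cvg_cst.
apply: (@cvgMl_tmp _ _ (nbhs x)); apply: (@cvgV _ _ (nbhs x)).
  by rewrite enorm_eq0 subr_eq0 xP.
exact: continuous_enormB.
Qed.

Lemma weight_continuous x : V x -> {for x, continuous f}.
Proof.
move=> Vx; apply: (@cvgM _ _ (nbhs x)); apply: potential_continuous => i ai;
  apply: (outer_region_avoids Vx); apply: contra ai.
  by rewrite paddr_eq0 // => /andP[].
by rewrite paddr_eq0 // => /andP[].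
Qed.

Local Notation g := (BLR_metric D al be).

Let f_gt0 (x : E) : 0 < f x.
Proof. exact: (weight_gt0 D al_ge0 be_ge0). Qed.

Lemma M_ge1 : 1 <= M.
Proof. by rewrite lerDl mulr_ge0. Qed.

(** The plane on which coordinate [k] equals [a] meets no open box. The values used are 0, the faces
    of boxes, and all [a] with [D <= |a|], which takes care of points outside the open cube. *)
Definition grid_coordinate (k : 'I_3) (a : R) :=
  forall j : box n, h <= `|a - p j 0 k|.

Lemma grid_off_center (x : E) k : grid_coordinate k (x 0 k) ->
  forall j : box n, off_center D x j.
Proof.
move=> gk j; exists k; have -> : (x - p j) 0 k = x 0 k - p j 0 k.
  by rewrite coordB.
exact: gk.
Qed.

(** An edge of the cube carries an even number of boxes, so coordinates of centers are odd multiples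
    of [h]. *)
Lemma grid_coordinate0 k : grid_coordinate k 0.
Proof.
move=> j; rewrite mxE sub0r normrN.
rewrite (_ : - D + _ = h * (2 * (j k)%:R + 1 - 2 * n%:R)); last first.
  by field; rewrite gt_eqF.
rewrite normrM (gtr0_norm h_gt0) -[leLHS]mulr1 ler_wpM2l ?(ltW h_gt0) //.
have : (j k < n)%N || (n <= j k)%N by case: ltnP.
move=> /orP[jn|jn]; rewrite ler_normr; apply/orP.
  right; have : (j k)%:R + 1 <= n%:R :> R by rewrite natr1 ler_nat.
  lra.
left; have : n%:R <= (j k)%:R :> R by rewrite ler_nat.
lra.
Qed.

Lemma grid_coordinate_outside k a : D <= `|a| -> grid_coordinate k a.
Proof.
move=> Da j; have := center_coord_le j k.
have := lerB_dist a (p j 0 k); lra.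
Qed.

Lemma weight_le_off_center x : (forall j : box n, off_center D x j) ->
  f x <= M ^+ 2.
Proof.
move=> off; rewrite expr2 ler_pM ?(ltW (potential_gt0 _ _ _)) //.
- exact: (potential_le_off_center D_gt0 n_gt0 al_ge0).
- exact: (potential_le_off_center D_gt0 n_gt0 be_ge0).
Qed.

Lemma joined_off_center (x y : E) (k : 'I_3) : eball 0 rad x -> eball 0 rad y ->
  x 0 k = y 0 k -> grid_coordinate k (x 0 k) ->
  joined g V (M ^+ 2 * enorm (y - x)) x y.
Proof.
move=> xb yb xy gk.
have off t : 0 <= t <= 1 -> forall j : box n, off_center D (segment x y t) j.
  move=> _; apply: (grid_off_center (k := k)).
  suff -> : segment x y t 0 k = x 0 k by [].
  by rewrite !mxE xy subrr mulr0 addr0.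
apply: (joined_segment_bounded f_gt0 weight_continuous) => t t01.
  by apply: outer_region_off_center; [exact: eball_segment | exact: off].
exact/weight_le_off_center/off.
Qed.

(* First move a second coordinate to [0], which is also a grid value, then
   slide to the origin inside that coordinate plane. *)
Lemma joined_grid_origin (z : E) k : eball 0 rad z ->
  grid_coordinate k (z 0 k) -> joined g V (M ^+ 2 * rad + M ^+ 2 * rad) z 0.
Proof.
move=> zb gk.
have [l lk] : exists l : 'I_3, l != k.
  by have [->|k0] := eqVneq k ord0; [exists ord_max | exists ord0; rewrite eq_sym].
pose z' := z - z 0 l *: basis_vector l.
have z'l : z' 0 l = 0 by rewrite !mxE !eqxx /= mulr1 subrr.
have z'E j : j != l -> z' 0 j = z 0 j.
  by move=> jl; rewrite !mxE (negbTE jl) andbF mulr0 subr0.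
have zle : enorm z' <= enorm z.
  rewrite -(@ler_pXn2r _ 2) ?nnegrE ?enorm_ge0 // !sqr_enorm.
  apply: ler_sum => j _; have [->|jl] := eqVneq j l.
    by rewrite z'l expr0n sqr_ge0.
  by rewrite z'E.
have z'b : eball 0 rad z'.
  by move: zb; rewrite /eball /= !subr0; exact: le_lt_trans.
have M2 : 0 <= M ^+ 2 by rewrite sqr_ge0.
have radE (B C : R) u v : B <= C -> joined g V B u v -> joined g V C u v.
  move=> BC [[cs1 p1 l1] [cs2 p2 l2]].
  by split; [exists cs1 | exists cs2] => //; exact: le_trans BC.
apply: (@joined_trans _ _ _ _ _ _ z').
  apply: radE (joined_off_center (k := k) zb z'b _ gk).
    rewrite ler_wpM2l // (_ : z' - z = - (z 0 l *: basis_vector l)); last first.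
      by rewrite /z' addrC addKr.
    rewrite enormN enormZ enorm_basis_vector mulr1.
    apply: le_trans (coord_le_enorm _ _) _; move: zb.
    by rewrite /eball /= subr0 => /ltW.
  by rewrite z'E // eq_sym.
apply: radE (joined_off_center (k := l) z'b _ _ _).
- rewrite ler_wpM2l // sub0r enormN; move: z'b.
  by rewrite /eball /= subr0 => /ltW.
- rewrite /eball /= subr0 enorm0; apply: lt_trans D_lt_rad; exact: D_gt0.
- by rewrite z'l mxE.
- by rewrite z'l; exact: grid_coordinate0.
Qed.

Lemma joined_le (B C : R) u v : B <= C -> joined g V B u v -> joined g V C u v.
Proof.
move=> BC [[cs1 p1 l1] [cs2 p2 l2]].
by split; [exists cs1 | exists cs2] => //; exact: le_trans BC.
Qed.

(** * Paths inside one box *)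

Section Box.
Variables (i : box n).

Definition in_box (x : E) := forall k, `|(x - p i) 0 k| <= h.

Lemma in_box_ball x : in_box x -> eball 0 rad x.
Proof.
move=> xi; apply: cube_sub_ball => k.
have := xi k; have := center_coord_le i k.
rewrite coordB => h1 h2.
by have := ler_normD (x 0 k - p i 0 k) (p i 0 k); rewrite subrK; lra.
Qed.

Lemma potential_in_box (a : box n -> R) x : in_box x ->
  (forall i, 0 <= a i) -> (forall i, a i <= s * D / n%:R ^+ 3) ->
  potential D a x <= M + a i / enorm (x - p i).
Proof.
move=> xi a0 a_le; rewrite (potential_background D a i) lerD2r lerD2l.
by apply: (sum_potential1_le D_gt0 n_gt0) => // j; exact: off_center_other.
Qed.

Lemma grid_face k a : `|a - p i 0 k| = h -> grid_coordinate k a.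
Proof.
move=> ai j; have [ij|ij] := eqVneq (i k) (j k).
  by move: ai; rewrite !mxE ij => ->.
have := center_separated_coord D_gt0 n_gt0 ij.
rewrite coordB; have -> : D / n%:R = h + h.
  by field; rewrite gt_eqF.
have := ler_normD (p i 0 k - a) (a - p j 0 k).
by rewrite addrA subrK (distrC _ a) ai; lra.
Qed.

Lemma segment_in_box x y t : in_box x -> in_box y -> 0 <= t <= 1 ->
  in_box (segment x y t).
Proof.
move=> xi yi /andP[t0 t1] k.
have -> : (segment x y t - p i) 0 k = (1 - t) * (x - p i) 0 k + t * (y - p i) 0 k.
  by rewrite /segment; move: (p i) => c; rewrite !mxE; ring.
apply: le_trans (ler_normD _ _) _; rewrite !normrM.
rewrite (ger0_norm t0) (ger0_norm (_ : 0 <= 1 - t)) ?subr_ge0 //.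
have h1 := ler_wpM2l (_ : 0 <= 1 - t) (xi k).
have h2 := ler_wpM2l t0 (yi k).
by move: (h1); rewrite subr_ge0 => /(_ t1); move: h2; lra.
Qed.

Lemma in_box_distance x : in_box x -> enorm (x - p i) <= D.
Proof.
move=> /enorm_le_coord /le_trans; apply.
have n1 : 1 <= n%:R :> R by rewrite ler1n.
rewrite (_ : 2 * h = D / n%:R); last by field; rewrite gt_eqF.
by rewrite ler_pdivrMr // ler_peMr // ltW.
Qed.

(** By [al_be] both masses vanish, so the box has no pole. The path follows a coordinate axis,
    because the radial direction is undefined at the center, which may belong to the region. *)
Lemma joined_neutral_box_face x : V x -> in_box x -> al i * be i = 0 ->
  exists z k, [/\ eball 0 rad z, grid_coordinate k (z 0 k) &
                  joined g V (M ^+ 2 * (2 * D)) x z].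
Proof.
move=> Vx xi abi.
have [ali bei] : al i = 0 /\ be i = 0.
  have /eqP : al i + be i = 0.
    by apply/eqP/negPn/negP => /al_be; rewrite abi eqxx.
  by rewrite paddr_eq0 // => /andP[/eqP -> /eqP ->].
pose z := x + (h - (x - p i) 0 ord0) *: basis_vector ord0.
have z0 : z 0 ord0 - p i 0 ord0 = h.
  by rewrite /z /basis_vector; move: (p i) => c; rewrite !mxE !eqxx /=; ring.
have zi : in_box z.
  move=> k; have [->|k0] := eqVneq k ord0.
    rewrite coordB z0 gtr0_norm //.
  have := xi k; rewrite /z /basis_vector; move: (p i) => c.
  by rewrite !mxE (negbTE k0) andbF mulr0 addr0.
exists z, ord0; split; first exact: in_box_ball.
  by apply: grid_face; rewrite z0 gtr0_norm.
have fM y : in_box y -> f y <= M ^+ 2.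
  move=> yi; rewrite expr2 ler_pM ?(ltW (potential_gt0 _ _ _)) //.
    by have := potential_in_box yi al_ge0 al_le; rewrite ali mul0r addr0.
  by have := potential_in_box yi be_ge0 be_le; rewrite bei mul0r addr0.
have si t : 0 <= t <= 1 -> in_box (segment x z t) by exact: segment_in_box.
have j : joined g V (M ^+ 2 * enorm (z - x)) x z.
  apply: (joined_segment_bounded f_gt0 weight_continuous) => t t01; last exact/fM/si.
  apply/outer_regionP; split; first exact/in_box_ball/si.
  move=> j abj; apply: Out_far => //; first exact/in_box_ball/si.
  apply: (@off_center_enorm _ _ n).
  apply: (off_center_other D_gt0 n_gt0 (i := i)); first exact: si.
  by apply/eqP => ji; move: abj; rewrite ji abi eqxx.
apply: joined_le j; rewrite ler_wpM2l ?sqr_ge0 //.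
have -> : z - x = (z - p i) - (x - p i) by rewrite opprB addrA subrK.
apply: le_trans (ler_enormD _ _) _; rewrite enormN.
by have := in_box_distance zi; have := in_box_distance xi; lra.
Qed.

(** The hypotheses give [lam ^ 2 <= 2 M ^ 2 D ^ 2 / (al i * be i)]; the loss of the neck radius is
    then absorbed by the crude bound [ln (2 M ^ 2) <= 2 M ^ 2]. *)
Lemma ln_stretch_le (lam rho : R) : 0 < al i * be i -> 0 < lam -> 0 < rho ->
  al i * be i / (2 * M ^+ 2) <= rho ^+ 2 -> lam * rho <= D ->
  ln lam <= M ^+ 2 + `|ln (al i * be i / D ^+ 2)|.
Proof.
move=> ab0 lam0 rho0 hrho hlam.
have M0 : 0 < M ^+ 2 by rewrite exprn_gt0 // (lt_le_trans ltr01 M_ge1).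
have q0 : 0 < al i * be i / D ^+ 2 by rewrite divr_gt0 // exprn_gt0.
have hl : lam ^+ 2 <= 2 * M ^+ 2 * (al i * be i / D ^+ 2)^-1.
  rewrite invf_div mulrA ler_pdivlMr //.
  apply: (@le_trans _ _ (lam ^+ 2 * (2 * M ^+ 2 * rho ^+ 2))).
    rewrite ler_wpM2l ?sqr_ge0 // [leRHS]mulrC -ler_pdivrMr //.
    by rewrite mulr_gt0.
  rewrite (_ : _ * _ = 2 * M ^+ 2 * (lam * rho) ^+ 2); last by ring.
  rewrite (ler_wpM2l (_ : 0 <= 2 * M ^+ 2)) //; first by rewrite ltW // mulr_gt0.
  have lr0 : 0 <= lam * rho by rewrite mulr_ge0 // ltW.
  by rewrite ler_pXn2r ?nnegrE ?(ltW D_gt0).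
have hln : 2 * ln lam <= ln (2 * M ^+ 2) - ln (al i * be i / D ^+ 2).
  have -> : 2 * ln lam = ln (lam ^+ 2) by rewrite lnXn // mulr_natl.
  have M20 : 0 < 2 * M ^+ 2 by rewrite mulr_gt0.
  have qi0 : 0 < (al i * be i / D ^+ 2)^-1 by rewrite invr_gt0.
  have l2 : 0 < lam ^+ 2 by rewrite exprn_gt0.
  by rewrite -lnV ?posrE // -lnM ?posrE // ler_ln ?posrE // (mulr_gt0 M20 qi0).
have hM : ln (2 * M ^+ 2) <= 2 * M ^+ 2.
  by rewrite ltW // ln_sublinear // mulr_gt0.
have := ler_norm (- ln (al i * be i / D ^+ 2)); rewrite normrN.
have := normr_ge0 (ln (al i * be i / D ^+ 2)); lra.
Qed.

(** The logarithm in the radial length has coefficient [M * (al i + be i)]; this bound turns the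
    summand [M ^ 2] of [ln_stretch_le] into [M ^ 2 D]. *)
Lemma mass_small : M * (al i + be i) <= D.
Proof.
have n1 : 1 <= n%:R :> R by rewrite ler1n.
have Mn : M <= n%:R by move: n_large s_ge0; lra.
have kap : al i + be i <= 2 * (s * D / n%:R ^+ 3).
  by have := al_le i; have := be_le i; lra.
have ab0 : 0 <= al i + be i by rewrite addr_ge0.
apply: (@le_trans _ _ (n%:R * (2 * (s * D / n%:R ^+ 3)))).
  by rewrite ler_pM ?(le_trans ler01 M_ge1).
rewrite (_ : _ * _ = 2 * s / n%:R ^+ 2 * D); last by field; rewrite gt_eqF.
rewrite -[leRHS]mul1r ler_wpM2r ?(ltW D_gt0) // ler_pdivrMr ?exprn_gt0 // mul1r.
apply: (@le_trans _ _ n%:R); first by move: n_large s_ge0; lra.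
by rewrite expr2 ler_peMl // ler0n.
Qed.

(** The integrand is [(M + al i / r) (M + be i / r)]. The constant term costs [M ^ 2 D], the
    logarithm another [M ^ 2 D] besides its main part, and the inverse-square term
    [al i * be i / rho <= 2 M ^ 2 D], by the lower bound for the neck radius. *)
Lemma joined_radial_box_face x : V x -> in_box x -> al i * be i != 0 ->
  exists z k, [/\ eball 0 rad z, grid_coordinate k (z 0 k) &
    joined g V (4 * M ^+ 2 * D +
                M * ((al i + be i) * `|ln (al i * be i / D ^+ 2)|)) x z].
Proof.
move=> Vx xi ab; have ab0 : 0 < al i * be i by rewrite lt_def ab mulr_ge0.
have [xb xO] := (outer_regionP x).1 Vx.
have [rho0 rho_ge] := Out_radius ab (xO i ab).
have rhoD := in_box_distance xi.
set v := x - p i in rho0 rho_ge rhoD xi *; set rho := enorm v in rho0 rho_ge rhoD.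
(* The ray from the center leaves the box through a face orthogonal to the largest coordinate of
   [v]; [lam] is the stretch bringing that coordinate to [h]. *)
have [k _ kmax] := @Order.TotalTheory.arg_maxP _ _ _ ord0 xpredT
     (fun k => `|v 0 k|) isT.
have {}kmax l : `|v 0 l| <= `|v 0 k| by exact: kmax.
set m := `|v 0 k| in kmax.
have m0 : 0 < m by have := enorm_le_coord kmax; rewrite -/rho; lra.
have mh : m <= h by exact: xi.
pose lam := h / m.
have lam1 : 1 <= lam by rewrite ler_pdivlMr // mul1r.
have lam0 : 0 < lam by exact: lt_le_trans lam1.
pose z := p i + lam *: v.
have zp : z - p i = lam *: v by rewrite /z addrC addKr.
have zi : in_box z.
  move=> l; rewrite zp mxE normrM gtr0_norm // /lam mulrAC ler_pdivrMr //.
  by rewrite ler_wpM2l // ltW.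
have lamrho : lam * rho <= D.
  by have := in_box_distance zi; rewrite zp enormZ gtr0_norm.
exists z, k; split; first exact: in_box_ball.
  apply: grid_face; rewrite -coordB zp mxE normrM gtr0_norm //.
  by rewrite -/m /lam divfK // gt_eqF.
pose mu t := 1 + t * (lam - 1).
have mu1 t : 0 <= t <= 1 -> 1 <= mu t.
  by move=> /andP[t0 _]; rewrite lerDl mulr_ge0 // subr_ge0.
have mu0 t : 0 <= t <= 1 -> 0 < mu t by move=> /mu1; exact: lt_le_trans.
have segE t : segment x z t = p i + mu t *: v.
  rewrite /segment /z /mu /v; move: (p i) => c.
  by apply/rowP => l; rewrite !mxE; ring.
have segp t : 0 <= t <= 1 -> enorm (segment x z t - p i) = mu t * rho.
  by move=> t01; rewrite segE addrC addKr enormZ gtr0_norm // mu0.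
have si t : 0 <= t <= 1 -> in_box (segment x z t) by exact: segment_in_box.
have zx : enorm (z - x) = (lam - 1) * rho.
  have -> : z - x = (lam - 1) *: v.
    by rewrite scalerBl scale1r -zp /v opprB addrA subrK.
  by rewrite enormZ ger0_norm // subr_ge0.
pose kap := al i + be i.
(* A primitive of the radial bound in the variable [r = mu t * rho], up to a constant. *)
pose G t := M ^+ 2 * rho * mu t + M * kap * ln (mu t)
            + - (al i * be i / rho) * (mu t)^-1.
pose dG t := (M + al i / (mu t * rho)) * (M + be i / (mu t * rho)) *
             ((lam - 1) * rho).
have dmu (t : R) : is_derive t 1 mu (lam - 1).
  by apply: is_derive_eq; rewrite /GRing.scale /=; ring.
have j : joined g V (G 1 - G 0) x z.
  apply: (@joined_segment R f V f_gt0 weight_continuous x z G dG) => t t01.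
  - apply/outer_regionP; split; first exact/in_box_ball/si.
    move=> j abj; have [ji|ji] := eqVneq j i.
      rewrite ji segE; apply: Out_outward => //; first exact: xO.
        exact: mu1.
      by rewrite -/v -segE; exact/in_box_ball/si.
    apply: Out_far => //; first exact/in_box_ball/si.
    apply: (@off_center_enorm _ _ n).
    by apply: (off_center_other D_gt0 n_gt0 (i := i)); first exact: si.
  - have m1 := mu0 _ t01; have mne : mu t != 0 by rewrite gt_eqF.
    have d1 := @is_derive_mulr R R (cst (M ^+ 2 * rho)) mu t 1 _ _
      (is_derive_cst _ _ _) (dmu t).
    have d2 := @is_derive_mulr R R (cst (M * kap)) (fun t => ln (mu t)) t 1 _ _
      (is_derive_cst _ _ _)
      (@is_derive_compr R R (@ln R) mu t 1 _ _ (is_derive1_ln m1) (dmu t)).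
    have d3 := @is_derive_mulr R R (cst (- (al i * be i / rho)))
      (fun t => (mu t)^-1) t 1 _ _ (is_derive_cst _ _ _)
      (@is_derive_invr R R mu t 1 _ mne (dmu t)).
    apply: (is_derive_eq (is_derive_addr (is_derive_addr d1 d2) d3)).
    by rewrite /dG /kap /=; field; rewrite mne gt_eqF.
  - have cmu : mu u @[u --> t] --> mu t.
      by apply: cvgD; [exact: cvg_cst | apply: cvgMr_tmp; exact: cvg_id].
    have mr : mu t * rho != 0 by rewrite mulf_neq0 // gt_eqF // mu0.
    apply: cvgMr_tmp; apply: cvgM; apply: cvgD; try exact: cvg_cst;
      by apply: cvgMl_tmp; apply: cvgV => //; exact: cvgMr_tmp.
  - rewrite zx /dG ler_wpM2r ?mulr_ge0 ?subr_ge0 ?(ltW rho0) //.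
    have := potential_in_box (si _ t01) al_ge0 al_le.
    have := potential_in_box (si _ t01) be_ge0 be_le.
    rewrite segp // => h2 h1.
    by rewrite ler_pM // ltW // potential_gt0.
apply: joined_le j.
have mu_1 : mu 1 = lam by rewrite /mu mul1r addrC subrK.
have mu_0 : mu 0 = 1 by rewrite /mu mul0r addr0.
rewrite /G mu_1 mu_0 ln1 mulr0 addr0 invr1 !mulr1.
have hln := ln_stretch_le ab0 lam0 rho0 rho_ge lamrho.
have ms := mass_small.
have M1 := M_ge1.
have M2 : 0 <= M ^+ 2 by exact: sqr_ge0.
have hab : al i * be i / rho <= 2 * M ^+ 2 * D.
  rewrite ler_pdivrMr //; apply: (@le_trans _ _ (2 * M ^+ 2 * rho ^+ 2)).
    rewrite [leRHS]mulrC -ler_pdivrMr // mulr_gt0 // exprn_gt0 //.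
    exact: lt_le_trans M1.
  rewrite [leLHS](_ : _ = 2 * M ^+ 2 * rho * rho); last by ring.
  by rewrite ler_wpM2r ?(ltW rho0) // ler_wpM2l // mulr_ge0.
have M0 : 0 <= M by exact: le_trans ler01 M1.
have kap0 : 0 <= M * kap by apply: mulr_ge0 => //; exact: addr_ge0.
have h1 : M ^+ 2 * rho * lam <= M ^+ 2 * D by rewrite -mulrA ler_wpM2l // mulrC.
have h2 : M * kap * ln lam <=
    M * kap * (M ^+ 2 + `|ln (al i * be i / D ^+ 2)|) by rewrite ler_wpM2l.
have h3 : M * kap * M ^+ 2 <= D * M ^+ 2 by rewrite ler_wpM2r.
have h4 : 0 <= M ^+ 2 * rho by rewrite mulr_ge0 // ltW.
have h5 : 0 <= al i * be i / rho * lam^-1.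
  by rewrite mulr_ge0 ?invr_ge0 ?divr_ge0 // ltW.
have -> : M * ((al i + be i) * `|ln (al i * be i / D ^+ 2)|) =
  M * kap * `|ln (al i * be i / D ^+ 2)| by rewrite mulrA.
move: h1 h2 h3 h4 h5 hab; rewrite mulNr mulrDr.
move: (al i * be i / rho) (M * kap) => u1 u2.
move: (`|ln _|) => u3; lra.
Qed.

End Box.

Lemma box_of (x : E) : (forall k, `|x 0 k| < D) -> exists i : box n, in_box i x.
Proof.
move=> xD; pose y k := (x 0 k + D) * n%:R / D.
have y0 k : 0 <= y k.
  rewrite divr_ge0 ?(ltW D_gt0) // mulr_ge0 ?ler0n //.
  by have := xD k; rewrite ltr_norml => /andP[]; lra.
(* The strict inequality [x_k < D] keeps the index below [2 n]. *)
have y2 k : (Num.truncn (y k) < 2 * n)%N.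
  rewrite truncn_lt_nat // natrM ltr_pdivrMr //.
  rewrite [ltRHS](_ : _ = (2 * D) * n%:R); last by ring.
  by rewrite ltr_pM2r //; have := xD k; rewrite ltr_norml => /andP[]; lra.
exists [ffun k => Ordinal (y2 k)] => k; rewrite coordB mxE ffunE /=.
have /andP[t1 t2] := truncn_itv (y0 k).
set t := (Num.truncn (y k))%:R in t1 *; rewrite -natr1 -/t in t2.
have -> : x 0 k - (- D + (t + 2^-1) * (D / n%:R)) = h * (2 * (y k - t) - 1).
  by rewrite /y; field; rewrite !gt_eqF.
rewrite normrM (gtr0_norm h_gt0) -[leRHS]mulr1 ler_wpM2l ?(ltW h_gt0) //.
by rewrite ler_norml; apply/andP; split; lra.
Qed.

(** * Bounds for the diameter *)

Local Notation l := (ell D al be).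

Lemma ell_ge i : al i * be i != 0 ->
  (al i + be i) * `|ln (al i * be i / D ^+ 2)| <= l * D.
Proof.
move=> ab; have abi : al i + be i != 0.
  apply: contra ab; rewrite paddr_eq0 // => /andP[/eqP -> _].
  by rewrite mul0r.
rewrite /ell [leRHS]mulrC mulVKf ?gt_eqF //.
exact: (le_bigmax_cond _ (fun i => (al i + be i) * `|ln (al i * be i / D ^+ 2)|)).
Qed.

Lemma ell_ge0 : 0 <= l.
Proof.
rewrite /ell mulr_ge0 ?invr_ge0 ?(ltW D_gt0) //.
exact: bigmax_ge_id.
Qed.

(** The constant is [4 + 2]: the radial part inside the box, then two moves inside grid planes at
    [M ^ 2 rad] each. *)
Lemma joined_origin x : V x -> joined g V (6 * M ^+ 2 * (rad + l * D)) x 0.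
Proof.
move=> Vx; have [xb _] := (outer_regionP x).1 Vx.
have Dr := D_lt_rad; have M1 := M_ge1.
have M0 : 0 <= M by exact: le_trans ler01 M1.
have M2 : M <= M ^+ 2 by rewrite expr2 ler_peMl.
have lD : 0 <= l * D by rewrite mulr_ge0 ?ell_ge0 // ltW.
have e1 : 0 <= M ^+ 2 * (l * D) by rewrite mulr_ge0 ?sqr_ge0.
have e2 : M ^+ 2 * D <= M ^+ 2 * rad by rewrite ler_wpM2l ?sqr_ge0 // ltW.
have e3 : M * (l * D) <= M ^+ 2 * (l * D) by rewrite ler_wpM2r.
have e4 : 0 <= M ^+ 2 * rad by rewrite mulr_ge0 ?sqr_ge0 // ltW // (lt_trans D_gt0).
have E6 : 6 * M ^+ 2 * (rad + l * D) = 6 * (M ^+ 2 * rad) + 6 * (M ^+ 2 * (l * D)).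
  by ring.
have E4 : 4 * M ^+ 2 * D = 4 * (M ^+ 2 * D) by ring.
have e5 : 0 <= M * (l * D) by exact: mulr_ge0.
have e6 : 0 <= M ^+ 2 * D by rewrite mulr_ge0 ?sqr_ge0 // ltW.
move: e1 e2 e3 e4 e5 e6 E6 E4.
set u1 := M ^+ 2 * (l * D); set u2 := M ^+ 2 * D; set u3 := M ^+ 2 * rad.
set u4 := M * (l * D) => e1 e2 e3 e4 e5 e6 E6 E4.
have finish z k B : eball 0 rad z -> grid_coordinate k (z 0 k) ->
    joined g V B x z -> B <= 4 * u2 + u4 ->
    joined g V (6 * M ^+ 2 * (rad + l * D)) x 0.
  move=> zb gz j BB.
  apply: joined_le (joined_trans j (joined_grid_origin zb gz)).
  by rewrite -/u3 E6; lra.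
have [[k Dk]|/forallNP xD] := pselect (exists k, D <= `|x 0 k|).
  have gk : grid_coordinate k (x 0 k) by exact: grid_coordinate_outside.
  apply: joined_le (joined_grid_origin xb gk).
  by rewrite -/u3 E6; lra.
have [i xi] : exists i, in_box i x.
  by apply: box_of => k; rewrite ltNge; apply/negP; exact: xD.
have [ab|ab] := eqVneq (al i * be i) 0.
  have [z [k [zb gz j]]] := joined_neutral_box_face Vx xi ab.
  apply: (finish z k _ zb gz j).
  by rewrite mulrCA -/u2; lra.
have [z [k [zb gz j]]] := joined_radial_box_face Vx xi ab.
apply: (finish z k _ zb gz j); rewrite E4 lerD2l.
by apply: (ler_wpM2l M0); exact: ell_ge.
Qed.

Lemma gdiam_le : (gdiam g V <= (12 * M ^+ 2 * (rad + l * D))%:E)%E.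
Proof.
apply: ge_ereal_sup => _ [[x y] /= [Vx Vy] <-].
have := joined_trans (joined_origin Vx) (joined_sym (joined_origin Vy)).
move=> /gdist_joined /le_trans; apply; rewrite lee_fin.
by rewrite -mulrDl -mulrDl; lra.
Qed.

Lemma gdist_le_gdiam x y : V x -> V y -> (gdist g V x y <= gdiam g V)%E.
Proof. by move=> Vx Vy; apply: ereal_sup_ubound; exists (x, y). Qed.

Lemma gdiam_ge_rad : (rad%:E <= gdiam g V)%E.
Proof.
(* As [D < c < rad], the points [x] and [y] are outside the cube but in the ball; their first
   coordinates differ by [D + rad]. *)
have Dr := D_lt_rad; pose c := (D + rad) / 2.
have c0 : 0 < c by rewrite divr_gt0 // addr_gt0 // (lt_trans D_gt0).
pose x : E := (- c) *: basis_vector ord0; pose y : E := c *: basis_vector ord0.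
have [x0 y0] : x 0 ord0 = - c /\ y 0 ord0 = c by rewrite !mxE !eqxx !mulr1.
have Vx : V x.
  apply: outer_region_off_center.
    rewrite /eball /= subr0 enormZ enorm_basis_vector mulr1 normrN gtr0_norm //.
    by rewrite /c; lra.
  apply: (grid_off_center (k := ord0)); apply: grid_coordinate_outside.
  by rewrite x0 normrN gtr0_norm // /c; lra.
have Vy : V y.
  apply: outer_region_off_center.
    by rewrite /eball /= subr0 enormZ enorm_basis_vector mulr1 gtr0_norm // /c; lra.
  apply: (grid_off_center (k := ord0)); apply: grid_coordinate_outside.
  by rewrite y0 gtr0_norm // /c; lra.
apply: le_trans (gdist_le_gdiam Vx Vy).
apply: le_trans (gdist_ge_coord f_gt0 weight_continuous ord0 x y _).
  by rewrite lee_fin x0 y0 /c; have := D_gt0; lra.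
by move=> z _; exact: weight_ge1.
Qed.

Lemma gdiam_ge_neck i : al i * be i != 0 ->
  (((al i + be i) * `|ln (al i * be i / D ^+ 2)| / 4)%:E <= gdiam g V)%E.
Proof.
move=> ab; have ab0 : 0 < al i * be i by rewrite lt_def ab mulr_ge0.
(* The sphere of this radius encloses the neck, whose squared radii are at most [2 (al i * be i)],
   less than [r ^ 2]. *)
pose r := 2 * Num.sqrt (al i * be i).
have sq0 : 0 < Num.sqrt (al i * be i) by rewrite sqrtr_gt0.
have r0 : 0 < r by rewrite mulr_gt0.
have n1 : 1 <= n%:R :> R by rewrite ler1n.
have hn2 : (4 * n%:R ^+ 2 * r) ^+ 2 <= D ^+ 2 / 4.
  have := product_small i; rewrite /r !exprMn sqr_sqrtr ?(ltW ab0) //.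
  lra.
have hn : 8 * n%:R ^+ 2 * r <= D.
  have D2 : 0 <= D / 2 by rewrite divr_ge0 // ltW.
  have : 4 * n%:R ^+ 2 * r <= D / 2.
    have nr : 0 <= 4 * n%:R ^+ 2 * r.
      by apply: mulr_ge0; [exact: mulr_ge0 (sqr_ge0 _) | exact: ltW].
    rewrite -(@ler_pXn2r _ 2) ?nnegrE // expr_div_n.
    by rewrite (_ : 2 ^+ 2 = 4 :> R) //; ring.
  lra.
have nn : n%:R <= n%:R ^+ 2 :> R by rewrite expr2 ler_peMr // ler0n.
have rh : r <= h.
  rewrite ler_pdivlMr ?mulr_gt0 //; apply: le_trans hn.
  by rewrite mulrC ler_wpM2r ?(ltW r0) //; lra.
pose x : E := p i + r *: basis_vector ord0.
have xp : x - p i = r *: basis_vector ord0 by rewrite /x addrC addKr.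
have xi : in_box i x.
  move=> k; rewrite xp; apply: le_trans (coord_le_enorm _ _) _.
  by rewrite enormZ enorm_basis_vector mulr1 gtr0_norm.
have Vx : V x.
  apply/outer_regionP; split; first exact: in_box_ball xi.
  move=> j abj; have [ji|ji] := eqVneq j i.
    rewrite ji; apply: Out_beyond => //; first exact: in_box_ball xi.
    move=> y Sy; have /andP[_ le2] :=
      neck_radius D_gt0 n_gt0 al_ge0 be_ge0 s_ge0 al_le be_le n_large ab
        (Sigma_neck ab) Sy.
    rewrite xp enormZ enorm_basis_vector mulr1 gtr0_norm //.
    rewrite -(@ltr_pXn2r _ 2) ?nnegrE ?enorm_ge0 ?(ltW r0) //.
    apply: le_lt_trans le2 _; rewrite /r exprMn sqr_sqrtr ?(ltW ab0) //.
    by move: ab0; lra.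
  apply: Out_far => //; first exact: in_box_ball xi.
  apply: (@off_center_enorm _ _ n).
  by apply: (off_center_other D_gt0 n_gt0 (i := i)).
have V0 : V 0.
  apply: outer_region_off_center.
    by rewrite /eball /= subr0 enorm0 (lt_trans D_gt0) // D_lt_rad.
  apply: (grid_off_center (k := ord0)); rewrite mxE; exact: grid_coordinate0.
have abs0 : 0 <= al i + be i by rewrite addr_ge0.
apply: le_trans (gdist_le_gdiam Vx V0).
have Vp : ~ V (p i).
  move=> Vp; have := outer_region_avoids Vp (i := i); rewrite eqxx => Vpi.
  suff /Vpi : al i + be i != 0 by [].
  apply: contra ab; rewrite paddr_eq0 // => /andP[/eqP -> _].
  by rewrite mul0r.
have fk z : V z -> (al i + be i) / enorm (z - p i) <= f z.
  move=> _; rewrite mulrDl /f !(potential_background D _ i).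
  have a0 : 0 <= al i / enorm (z - p i) by rewrite divr_ge0 ?enorm_ge0.
  have b0 : 0 <= be i / enorm (z - p i) by rewrite divr_ge0 ?enorm_ge0.
  have h1 : 1 + al i / enorm (z - p i) <= background D al i z + al i / enorm (z - p i).
    by rewrite lerD2r background_ge1.
  have h2 : 1 + be i / enorm (z - p i) <= background D be i z + be i / enorm (z - p i).
    by rewrite lerD2r background_ge1.
  apply: le_trans (ler_pM _ _ h1 h2); rewrite ?addr_ge0 //.
  have := mulr_ge0 a0 b0; lra.
apply: le_trans (gdist_ge_log f_gt0 weight_continuous x 0 abs0 Vp fk).
rewrite lee_fin xp enormZ enorm_basis_vector mulr1 (gtr0_norm r0) sub0r enormN.
rewrite -mulrBr -mulrA ler_wpM2l //.
(* The other endpoint is the origin, at distance at least [h] from every center because 0 is a grid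
   value. *)
have hp : h <= enorm (p i).
  apply: le_trans (coord_le_enorm _ ord0).
  by have := @grid_coordinate0 ord0 i; rewrite sub0r normrN.
apply: (@le_trans _ _ (ln h - ln r)); last first.
  by rewrite lerD2r ler_ln ?posrE // (lt_le_trans _ hp).
have q0 : 0 < al i * be i / D ^+ 2 by rewrite divr_gt0 // exprn_gt0.
have q1 : al i * be i / D ^+ 2 <= 1.
  rewrite ler_pdivrMr ?exprn_gt0 // mul1r; apply: le_trans (product_small i).
  rewrite ler_peMl ?(ltW ab0) //.
  have : 1 <= n%:R ^+ 4 :> R by rewrite exprn_ege1.
  lra.
rewrite ler0_norm ?ln_le0 //.
(* Both sides compare after multiplication by 4, since
   [(h / r) ^ 4 * (al i * be i / D ^ 2) = D ^ 2 / (256 n ^ 4 al i be i) >= 1]. *)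
have key : 1 <= (h / r) ^+ 4 * (al i * be i / D ^+ 2).
  have r4 : r ^+ 4 = 16 * (al i * be i) ^+ 2.
    have := sqr_sqrtr (ltW ab0); rewrite /r; move: (Num.sqrt _) => q <-.
    by ring.
  rewrite expr_div_n r4 expr_div_n.
  rewrite [leRHS](_ : _ = D ^+ 2 / (256 * n%:R ^+ 4 * (al i * be i))).
    have c0 : 0 < 256 * n%:R ^+ 4 * (al i * be i).
      by apply: mulr_gt0 (mulr_gt0 _ (exprn_gt0 4 nR_gt0)) ab0; rewrite ltr0n.
    by rewrite (ler_pdivlMr _ _ c0) mul1r; exact: product_small.
  by move: ab0; move: (al i * be i) => w w0; field; rewrite !gt_eqF.
have hr0 : 0 < h / r by rewrite divr_gt0.
have lnhr : ln (h / r) = ln h - ln r by rewrite (@ln_div _ h r) ?posrE.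
move: (al i * be i / D ^+ 2) q0 key => q q0 key.
have : ln 1 <= ln ((h / r) ^+ 4 * q).
  by rewrite ler_ln ?posrE // mulr_gt0 // exprn_gt0.
rewrite ln1 lnM ?posrE ?exprn_gt0 // lnXn // lnhr.
by move: (ln q) (ln h) (ln r) => u1 u2 u3; lra.
Qed.

End OuterRegion.

(** * Constants of class C *)

Section DensityBounds.
Context {R : realType}.
Local Notation E := 'rV[R]_3.

Lemma compact_cube (D : R) : compact (@cube R D).
Proof.
rewrite (_ : cube D = [set v : E | forall k, `[- D, D]%classic (v ord0 k)]).
  apply: (@rV_compact _ _ (fun=> `[- D, D]%classic)) => k.
  exact: segment_compact.
apply/seteqP; split => x /= h k; first by rewrite in_itv /=; exact: h.
by have := h k; rewrite in_itv.
Qed.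

(** [supnorm] is a bare supremum: it dominates the values only because [A] is continuous and
    vanishes off a compact cube, hence is bounded. *)
Lemma supnorm_ge (D : R) (A : E -> R) : 0 < D -> smooth A ->
  fsupport A `<=` cube D -> forall x, `|A x| <= supnorm A.
Proof.
move=> D0 sA supA x.
apply: (@ub_le_sup R [set `|A x| | x in [set: E]]); last by exists x.
have cA : continuous (fun x => `|A x|).
  move=> y; apply: (@continuous_comp _ _ _ A (fun t : R => `|t|)).
    by apply: differentiable_continuous; exact: smooth_differentiable.
  exact: norm_continuous.
have cube0 : @cube R D !=set0.
  by exists 0 => k; rewrite mxE oppr_le0 ltW.
have [c _ maxc] := compact_EVT_max cube0 (@compact_cube D) (continuous_subspaceT cA).
exists `|A c| => _ [y _ <-].
have [Dy|Dy] := pselect (cube D y); first by apply: maxc; exact: mem_set.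
suff -> : A y = 0 by rewrite normr0.
apply/eqP/negPn/negP => Ay; apply: Dy; apply: supA.
exact: subset_closure.
Qed.

Lemma defect_ge (D : R) (A : E -> R) (alpha : forall n, box n -> R) n (i : box n) :
  has_ubound (defects D A alpha) ->
  n%:R ^+ 4 * `|alpha n i - A (Defs.center D i) * (D / n%:R) ^+ 3|
    <= defect D A alpha.
Proof. by move=> ub; apply: (@ub_le_sup R (defects D A alpha)) => //; exists n, i. Qed.

(** One factor [n] of the defect bound is given up, so that both contributions scale like the volume
    of a box. *)
Lemma BLR_mass_le (D : R) (A : E -> R) (alpha : forall n, box n -> R) n (i : box n) :
  0 < D -> (0 < n)%N -> smooth A -> fsupport A `<=` cube D ->
  has_ubound (defects D A alpha) ->
  alpha n i <= (supnorm A * D ^+ 2 + defect D A alpha / D) * D / n%:R ^+ 3.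
Proof.
move=> D0 n0 sA supA ub; have h1 := defect_ge i ub.
have h2 := supnorm_ge D0 sA supA (Defs.center D i).
have nR : 0 < n%:R :> R by rewrite ltr0n.
have n1 : 1 <= n%:R :> R by rewrite ler1n.
set e := `|_| in h1.
have e0 : 0 <= e by exact: normr_ge0.
have h3 : n%:R ^+ 3 * e <= defect D A alpha.
  apply: le_trans h1; rewrite ler_wpM2r //.
  by rewrite [leRHS]exprS ler_peMl ?exprn_ge0 // ltW.
have h4 : alpha n i <= A (Defs.center D i) * (D / n%:R) ^+ 3 + e.
  have := ler_norm (alpha n i - A (Defs.center D i) * (D / n%:R) ^+ 3).
  by rewrite -/e; lra.
apply: le_trans h4 _; rewrite ler_pdivlMr ?exprn_gt0 // mulrDl.
have -> : A (Defs.center D i) * (D / n%:R) ^+ 3 * n%:R ^+ 3 =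
  A (Defs.center D i) * D ^+ 3 by field; rewrite gt_eqF.
have -> : (supnorm A * D ^+ 2 + defect D A alpha / D) * D =
   supnorm A * D ^+ 3 + defect D A alpha by field; rewrite gt_eqF.
apply: lerD; last by rewrite mulrC.
rewrite ler_wpM2r ?exprn_ge0 ?(ltW D0) //.
exact: le_trans (ler_norm _) h2.
Qed.

Lemma defect_ge0 (D : R) (A : E -> R) (alpha : forall n, box n -> R) :
  has_ubound (defects D A alpha) -> 0 <= defect D A alpha.
Proof.
(* A box at [n = 1] shows that the supremum is over a nonempty set of nonnegative numbers. *)
move=> ub; have i : box 1 := [ffun=> ord0].
apply: le_trans (defect_ge i ub); rewrite mulr_ge0 ?normr_ge0 //.
Qed.

Lemma supnorm_ge0 (D : R) (A : E -> R) : 0 < D -> smooth A ->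
  fsupport A `<=` cube D -> 0 <= supnorm A.
Proof. by move=> D0 sA supA; exact: le_trans (supnorm_ge D0 sA supA 0). Qed.

End DensityBounds.

(** * Polynomials with non-negative coefficients *)

Import (canonicals) mpoly.

Section ClassConstants.
Context {R : realType}.

Definition nonneg_coefficients (P : mpoly.mpoly 4 R) :=
  forall m, 0 <= mpoly.mcoeff m P.

Lemma nonneg_coefficientsD P Q : nonneg_coefficients P ->
  nonneg_coefficients Q -> nonneg_coefficients (P + Q).
Proof. by move=> hP hQ m; rewrite mpoly.mcoeffD addr_ge0. Qed.

Lemma nonneg_coefficientsM P Q : nonneg_coefficients P ->
  nonneg_coefficients Q -> nonneg_coefficients (P * Q).
Proof.
by move=> hP hQ m; rewrite mpoly.mcoeffM sumr_ge0 // => k _; exact: mulr_ge0.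
Qed.

Lemma nonneg_coefficients_nat k : nonneg_coefficients k%:R.
Proof.
move=> m; rewrite mpoly.mcoeffMn mulrn_wge0 // mpoly.mcoeff1.
exact: ler0n.
Qed.

Definition class_params_sum : mpoly.mpoly 4 R :=
  \sum_(k < 4) mpoly.mpolyX R (mpoly.mnm1 k).

Lemma class_params_sum_nonneg : nonneg_coefficients class_params_sum.
Proof.
rewrite /class_params_sum; elim/big_ind: _ => [m|P Q|k _ m].
- by rewrite mpoly.mcoeff0.
- exact: nonneg_coefficientsD.
- by rewrite mpoly.mcoeffX ler0n.
Qed.

(** The factor [12 M ^ 2] of the upper bound: twice the cost of joining a point to the origin. *)
Definition diameter_constant : mpoly.mpoly 4 R :=
  12%:R * ((1 + 104%:R * class_params_sum) * (1 + 104%:R * class_params_sum)).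

Definition size_constant : mpoly.mpoly 4 R :=
  1000%:R * (1 + class_params_sum).

Lemma size_constant_nonneg : nonneg_coefficients size_constant.
Proof.
apply: nonneg_coefficientsM; first exact: nonneg_coefficients_nat.
apply: nonneg_coefficientsD; last exact: class_params_sum_nonneg.
exact: (nonneg_coefficients_nat 1).
Qed.

Lemma diameter_constant_nonneg : nonneg_coefficients diameter_constant.
Proof.
have M : nonneg_coefficients (1 + 104%:R * class_params_sum).
  apply: nonneg_coefficientsD; first exact: (nonneg_coefficients_nat 1).
  apply: nonneg_coefficientsM; first exact: nonneg_coefficients_nat.
  exact: class_params_sum_nonneg.
apply: nonneg_coefficientsM; first exact: nonneg_coefficients_nat.
exact: nonneg_coefficientsM.
Qed.

Variables (D : R) (A B : 'rV[R]_3 -> R) (alpha beta : forall n, box n -> R).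

Definition params_total : R :=
  supnorm A * D ^+ 2 + supnorm B * D ^+ 2
  + defect D A alpha / D + defect D B beta / D.

Lemma class_const_sum : class_const D class_params_sum A B alpha beta = params_total.
Proof.
rewrite /class_const /class_params_sum raddf_sum /=.
under eq_bigr do rewrite mpoly.mevalXU.
by rewrite !big_ord_recl big_ord0 addr0 /class_params /= !addrA.
Qed.

Lemma class_const_nat (k : nat) :
  mpoly.meval (class_params D A B alpha beta) k%:R = k%:R.
Proof. by rewrite mpoly.mevalMn mpoly.meval1. Qed.

Lemma class_const_size :
  class_const D size_constant A B alpha beta = 1000 * (1 + params_total).
Proof.
rewrite -class_const_sum /class_const /size_constant mpoly.mevalM.
by rewrite class_const_nat mpoly.mevalD mpoly.meval1.
Qed.

Lemma class_const_diameter :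
  class_const D diameter_constant A B alpha beta =
  12 * (1 + 104 * params_total) ^+ 2.
Proof.
rewrite -class_const_sum /class_const /diameter_constant expr2.
rewrite !mpoly.mevalM class_const_nat mpoly.mevalD mpoly.meval1 mpoly.mevalM.
by rewrite class_const_nat.
Qed.

End ClassConstants.

(** Both polynomials are chosen before the data and the radius, which makes their coefficients
    universal. The bounds hold for every family of surfaces satisfying [neck_surface]. *)
Theorem lemma5p3 (R : realType) :
  exists C N : mpoly.mpoly 4 R,
    (forall m, 0 <= mpoly.mcoeff m C) /\
    (forall m, 0 <= mpoly.mcoeff m N) /\
    forall (D : R) (A B : 'rV[R]_3 -> R) (alpha beta : forall n, box n -> R)
           (rad : R),
      0 < D ->
      smooth A -> (forall x, 0 <= A x) -> fsupport A `<=` cube D ->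
      smooth B -> (forall x, 0 <= B x) -> fsupport B `<=` cube D ->
      BLR_sum D A B alpha beta ->
      (forall n, Pstarstar D (alpha n) (beta n) = Pstar D (alpha n) (beta n)) ->
      Num.sqrt 3 * D < rad ->
      forall n : nat, (0 < n)%N ->
      class_const D N A B alpha beta <= n%:R ->
      forall Sigma : box n -> set 'rV[R]_3,
      (forall i, alpha n i * beta n i != 0 ->
         neck_surface D (alpha n) (beta n) i (Sigma i)) ->
      let c := class_const D C A B alpha beta in
      let l := ell D (alpha n) (beta n) in
      let diam := gdiam (BLR_metric D (alpha n) (beta n))
                    (outer_region D (alpha n) (beta n) rad Sigma) in
      ((c^-1 * (rad + l * D))%:E <= diam)%E /\
      (diam <= (c * (rad + l * D))%:E)%E.
Proof.
exists diameter_constant, size_constant; split; first exact: diameter_constant_nonneg.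
split; first exact: size_constant_nonneg.
move=> D A B alpha beta rad D0 sA A0 supA sB B0 supB [al0 be0 dA dB] PP radD n n0.
rewrite class_const_diameter class_const_size.
set s := params_total _ _ _ _ _ => n_large Sigma neck c l diam.
have sA0 : 0 <= supnorm A * D ^+ 2.
  by rewrite mulr_ge0 ?sqr_ge0 // (supnorm_ge0 D0 sA supA).
have sB0 : 0 <= supnorm B * D ^+ 2.
  by rewrite mulr_ge0 ?sqr_ge0 // (supnorm_ge0 D0 sB supB).
have dA0 : 0 <= defect D A alpha / D by rewrite divr_ge0 ?(ltW D0) // defect_ge0.
have dB0 : 0 <= defect D B beta / D by rewrite divr_ge0 ?(ltW D0) // defect_ge0.
have s0 : 0 <= s by rewrite /s /params_total !addr_ge0.
have D_n3 : 0 <= D / n%:R ^+ 3 by rewrite divr_ge0 ?exprn_ge0 ?ler0n // ltW.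
have al_le i : alpha n i <= s * D / n%:R ^+ 3.
  apply: le_trans (BLR_mass_le i D0 n0 sA supA dA) _.
  by rewrite -!mulrA ler_wpM2r // /s /params_total; lra.
have be_le i : beta n i <= s * D / n%:R ^+ 3.
  apply: le_trans (BLR_mass_le i D0 n0 sB supB dB) _.
  by rewrite -!mulrA ler_wpM2r // /s /params_total; lra.
(* The equality of sets of centers becomes a statement about each box because distinct boxes have
   distinct centers. *)
have al_be i : alpha n i + beta n i != 0 -> alpha n i * beta n i != 0.
  move=> abi; have : Pstar D (alpha n) (beta n) (Defs.center D i) by exists i.
  by rewrite -PP => -[j /= abj /(center_inj D0 n0) <-].
have le_c := gdiam_le D0 n0 s0 (al0 n) (be0 n) al_le be_le n_large al_be radD neck.
split; last exact: le_c.
have ge_rad := gdiam_ge_rad D0 n0 s0 (al0 n) (be0 n) al_le be_le n_large al_be radD neck.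
have ge_neck i := gdiam_ge_neck D0 n0 s0 (al0 n) (be0 n) al_le be_le n_large
  al_be radD neck (i := i).
have c12 : 12 <= c.
  have M1 : 1 <= (1 + 104 * s) ^+ 2 by rewrite exprn_ege1 // lerDl mulr_ge0.
  by rewrite /c; lra.
rewrite -/diam in le_c ge_rad ge_neck *.
(* The upper bound excludes an infinite diameter, so the lower bounds can be combined as real
   inequalities. *)
case: diam le_c ge_rad ge_neck => [d||//]; last first.
  by rewrite leNgt ltry.
rewrite !lee_fin => _ rad_d neck_d.
have rad0 : 0 < rad by apply: lt_trans D0 (D_lt_rad D0 radD).
have l_d : l * D <= 4 * d.
  rewrite /l /ell mulrAC mulVf ?gt_eqF // mul1r; apply: bigmax_le.
    by lra.
  move=> i /al_be /neck_d; rewrite lee_fin; lra.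
have c0 : 0 < c by lra.
(* [rad <= d] and [l * D <= 4 d] add up to [5 d], and 5 is below [12 <= c]. *)
rewrite mulrC ler_pdivrMr //; apply: (@le_trans _ _ (5 * d)); first by lra.
by rewrite mulrC ler_wpM2l //; lra.
Qed.
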